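(* Let $R$ be a Cohen-Macaulay local ring, and let $M$ be a maximal Cohen-Macaulay $R$-module. Let $L$ be a non-zero homomorphic image of a finite direct sum of syzygy modules $\Omega_n^R(M)$ with $n \ge 1$. Then $L$ cannot be a semidualizing $R$-module. In particular, $L$ cannot be a free $R$-module, and $L$ cannot be a maximal Cohen-Macaulay $R$-module of finite injective dimension.
   Context: All rings are commutative Noetherian local rings and all modules are finitely generated. For an $R$-module $M$ and $n \ge 0$, $\Omega_n^R(M)$ denotes the $n$th syzygy module of $M$, i.e. the image of the $n$th differential of an augmented minimal free resolution of $M$ (so $\Omega_0^R(M) = M$); it is unique up to isomorphism. A finite direct sum of $\Omega_n^R(M)$, $n\ge 1$, means a module $\bigoplus_{n \in \Lambda} (\Omega_n^R(M))^{j_n}$, where $\Lambda$ is a finite set of positive integers and each $j_n$ is a positive integer. A maximal Cohen-Macaulay $R$-module is a non-zero $R$-module $M$ with $\mathrm{depth}(M) = \dim(R)$. An $R$-module $C$ is semidualizing if (i) the natural homomorphism $R \to \mathrm{Hom}_R(C,C)$ is an isomorphism, and (ii) $\mathrm{Ext}_R^i(C,C) = 0$ for all $i \ge 1$. *)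

(* Defs.v *)
From HB Require Import structures.
From mathcomp Require Import all_boot all_order all_algebra ring_quotient.
From mathcomp Require Import boolp classical_sets.

Set Implicit Arguments.
Unset Strict Implicit.
Unset Printing Implicit Defensive.

Import GRing.Theory.
Local Open Scope ring_scope.
Local Open Scope classical_set_scope.

(* Ideals are Prop-valued sets, so that no decidability is assumed; [in I] is
   the boolean predicate (by classical choice) that ring_quotient expects.
   Note that idealr_closed only holds of proper ideals. *)
Section Rings.
Variable R : comNzRingType.

Definition proper_ideal_set (I : set R) : Prop := idealr_closed [in I].

Definition prime_ideal (p : set R) : Prop :=
  proper_ideal_set p /\ prime_idealr_closed [in p].

Definition maximal_ideal (m : set R) : Prop :=
  proper_ideal_set m /\
  forall I : set R, proper_ideal_set I -> m `<=` I -> I = m.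

Definition local_ring_with (m : set R) : Prop :=
  maximal_ideal m /\ forall n : set R, maximal_ideal n -> n = m.

(* The unit ideal is generated by 1, so only proper ideals need be tested. *)
Definition noetherian : Prop :=
  forall I : set R, proper_ideal_set I ->
  exists (n : nat) (a : 'I_n -> R),
    I = [set x | exists c : 'I_n -> R, x = \sum_i c i * a i].

Definition prime_chain (n : nat) (p : nat -> set R) : Prop :=
  (forall i, (i <= n)%N -> prime_ideal (p i)) /\
  (forall i, (i < n)%N -> p i `<` p i.+1).

Definition krull_dim_eq (d : nat) : Prop :=
  (exists p, prime_chain d p) /\
  (forall n p, prime_chain n p -> (n <= d)%N).

End Rings.

Arguments noetherian : clear implicits.
Arguments krull_dim_eq : clear implicits.

Section Modules.
Variable R : comNzRingType.
Implicit Types (M N L C J : lmodType R) (m : set R).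

Definition finitely_generated M : Prop :=
  exists (n : nat) (e : 'I_n -> M),
    forall x, exists c : 'I_n -> R, x = \sum_i c i *: e i.

Definition nonzero_module M : Prop := exists x : M, x <> 0.

Definition finite_free M : Prop :=
  exists (n : nat) (f : {linear 'rV[R]_n -> M}), bijective f.

Definition homomorphic_image N L : Prop :=
  exists p : {linear N -> L}, forall y, exists x, p x = y.

(* (x_1, ..., x_k) M *)
Definition seq_mul_module (xs : seq R) M : set M :=
  [set z | exists c : 'I_(size xs) -> M, z = \sum_(i < size xs) xs`_i *: c i].

(* The second clause says that x_{i+1} is a nonzerodivisor on
   M / (x_1, ..., x_i) M. *)
Definition regular_sequence (xs : seq R) M : Prop :=
  (exists z : M, ~ seq_mul_module xs z) /\
  forall i, (i < size xs)%N -> forall z : M,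
    seq_mul_module (take i xs) (xs`_i *: z) -> seq_mul_module (take i xs) z.

Definition depth_eq m M (d : nat) : Prop :=
  (exists xs : seq R, [/\ forall x, x \in xs -> m x,
     regular_sequence xs M & size xs = d]) /\
  (forall xs : seq R, (forall x, x \in xs -> m x) ->
     regular_sequence xs M -> (size xs <= d)%N).

Definition maximal_cohen_macaulay m M : Prop :=
  nonzero_module M /\ exists d, depth_eq m M d /\ krull_dim_eq R d.

(* Resolutions by free modules of finite rank, F_i = R^(fr_rank i), with
   fr_diff i : F_(i+1) -> F_i. *)
Record free_resolution M := FreeResolution {
  fr_rank : nat -> nat;
  fr_aug : {linear 'rV[R]_(fr_rank 0) -> M};
  fr_diff : forall i, {linear 'rV[R]_(fr_rank i.+1) -> 'rV[R]_(fr_rank i)};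
  fr_surj : forall x, exists v, fr_aug v = x;
  fr_exact0 : forall v, fr_aug v = 0 <-> exists w, v = fr_diff 0 w;
  fr_exact : forall i v, fr_diff i v = 0 <-> exists w, v = fr_diff i.+1 w }.

Definition minimal_resolution m M (F : free_resolution M) : Prop :=
  forall i v k, m (fr_diff F i v 0 k).

Section Image.
Variables (U V : lmodType R) (f : {linear U -> V}).

Definition linear_image : {pred V} := fun v => `[< exists u, v = f u >].

Lemma linear_image_submod_closed : submod_closed linear_image.
Proof.
split=> [|a x y /asboolP[u ->] /asboolP[v ->]]; apply/asboolP.
  by exists 0; rewrite raddf0.
by exists (a *: u + v); rewrite linearP.
Qed.

HB.instance Definition _ :=
  GRing.isSubmodClosed.Build R V linear_image linear_image_submod_closed.

Record image_module := ImageModule {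
  image_val : V; image_valP : image_val \in linear_image }.

HB.instance Definition _ := [isSub for image_val].
HB.instance Definition _ := [Choice of image_module by <:].
HB.instance Definition _ := [SubChoice_isSubLmodule of image_module by <:].

End Image.

(* The n-th differential (n >= 1) of the augmented resolution is
   fr_diff F n.-1 : F_n -> F_(n-1), the 0-th one being the augmentation. *)
Definition syzygy M (F : free_resolution M) (n : nat) : lmodType R :=
  if n is k.+1 then image_module (fr_diff F k) else M.

(* The external direct sum of the Z n ^ (j n), for n ranging over s. *)
Fixpoint direct_sum (Z : nat -> lmodType R) (j : nat -> nat) (s : seq nat) :
    lmodType R :=
  if s is n :: s' then ({ffun 'I_(j n) -> Z n} * direct_sum Z j s')%type
  else 'rV[R]_0.

(* Ext^(i+1)(M, N) = 0, i.e., exactness of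
   Hom(F_i, N) -> Hom(F_(i+1), N) -> Hom(F_(i+2), N). This does not depend on
   F, which exists for any finitely generated M over a noetherian R. *)
Definition ext_succ_eq0 (i : nat) M N : Prop :=
  exists F : free_resolution M,
  forall f : {linear 'rV[R]_(fr_rank F i.+1) -> N},
    (forall w, f (fr_diff F i.+1 w) = 0) ->
    exists g : {linear 'rV[R]_(fr_rank F i) -> N},
      forall v, f v = g (fr_diff F i v).

Definition homothety C (r : R) : {linear C -> C} := *:%R r.

Definition semidualizing C : Prop :=
  bijective (homothety C) /\ forall i, ext_succ_eq0 i C C.

Definition injective_module J : Prop :=
  forall (A B : lmodType R) (i : {linear A -> B}) (f : {linear A -> J}),
    injective i -> exists g : {linear B -> J}, forall a, g (i a) = f a.

Record injective_resolution L := InjectiveResolution {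
  ir_obj : nat -> lmodType R;
  ir_aug : {linear L -> ir_obj 0};
  ir_diff : forall i, {linear ir_obj i -> ir_obj i.+1};
  ir_injective : forall i, injective_module (ir_obj i);
  ir_inj : injective ir_aug;
  ir_exact0 : forall v, ir_diff 0 v = 0 <-> exists w, v = ir_aug w;
  ir_exact : forall i v, ir_diff i.+1 v = 0 <-> exists w, v = ir_diff i w }.

Definition finite_injective_dimension L : Prop :=
  exists (n : nat) (E : injective_resolution L),
    forall i, (n < i)%N -> forall x : ir_obj E i, x = 0.

End Modules.

(* R^o is R as a module over itself. *)
Definition cohen_macaulay (R : comNzRingType) (m : set R) : Prop :=
  exists d, depth_eq m R^o d /\ krull_dim_eq R d.

(* Main.v *)
From HB Require Import structures.
Require Import Defs.
From mathcomp Require Import all_boot all_order all_algebra ring_quotient.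
From mathcomp Require Import generic_quotient.
From mathcomp Require Import boolp classical_sets ring.

(** Let d = dim R. Since R and M, and also L in the third case, have regular
    sequences of length d in m, they have a common one, xs (common_regular); let
    X be the ideal that it generates. A prime p containing X other than m would
    sit at the top of a chain of d + 1 primes (prime_chain_below), and m would
    lengthen that chain; so m is the only prime over X. Hence R/X has a nonzero
    socle: there is s outside X with m s inside X (exists_socle).

    As xs is regular on M and on R, it is regular on all syzygies, and the
    inclusion of the n-th syzygy in F_(n-1) stays injective modulo X
    (regular_kernel). By minimality that syzygy lies in m F_(n-1), which s sends
    into X F_(n-1). So s maps each syzygy Z into XZ, hence a direct sum of
    syzygies into X times itself, and therefore L into XL. The three cases
    contradict sL <= XL, since s is not in X.

    - If L is free and nonzero, R/X acts faithfully on L/XL.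
    - If L is semidualizing, adding one element x of xs at a time shows that
      Hom(L, L/XL) = R/X and Ext^i(L, L/XL) = 0 for i > 0
      (semidualizing_mod_add); so R/X acts faithfully on L/XL. That x is regular
      on L modulo the previous elements holds because a zero-divisor would give
      a nonzero map from L to some R/p inside the quotient of L, which is the
      multiplication by an element of a ring on which x is regular.
    - If L is maximal Cohen-Macaulay of finite injective dimension, L/XL has
      finite injective dimension over the artinian ring R/X (inj_dim_mod), so it
      is injective (inj_dim_extends_multiples). Pick u in L/XL nonzero and
      killed by m. The map to L/XL from the ideal generated by s in R/X, a copy of
      the residue field, that sends s to u extends to R/X, so u = s w for some
      w. *)

Set Implicit Arguments.
Unset Strict Implicit.
Unset Printing Implicit Defensive.

Import GRing.Theory.
Local Open Scope ring_scope.
Local Open Scope classical_set_scope.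

(** * Submodules and Noetherian modules *)

Section Submodules.
Variables (R : comNzRingType) (V : lmodType R).
Implicit Types (K U : set V) (x y z : V) (a b : R).

(** Submodules are Prop-valued sets; a statement on the quotient V/K is phrased
    in V, as a statement modulo K. *)
Definition submodule K : Prop :=
  K 0 /\ forall a x y, K x -> K y -> K (a *: x + y).

Definition add_line K x : set V := [set z | exists a, K (z - a *: x)].
(** K + aV, the kernel of V -> (V/K)/a(V/K). *)
Definition add_multiples K a : set V := [set z | exists w, K (z - a *: w)].
Definition span : seq V -> set V := foldr (fun x K => add_line K x) [set 0].

Section Closure.
Variables (K : set V) (subK : submodule K).

Lemma submodD x y : K x -> K y -> K (x + y).
Proof. by move=> Kx Ky; rewrite -[x]scale1r; apply: subK.2. Qed.

Lemma submodZ a x : K x -> K (a *: x).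
Proof.
by move=> Kx; rewrite -[_ *: _]addr0; apply: subK.2 => //; case: subK.
Qed.

Lemma submodN x : K x -> K (- x).
Proof. by move=> Kx; rewrite -scaleN1r; apply: submodZ. Qed.

Lemma submodB x y : K x -> K y -> K (x - y).
Proof. by move=> Kx Ky; apply: submodD => //; apply: submodN. Qed.

Lemma submod_sum (I : Type) (r : seq I) (f : I -> V) :
  (forall i, K (f i)) -> K (\sum_(i <- r) f i).
Proof.
move=> Kf; elim: r => [|i r IHr]; first by rewrite big_nil; case: subK.
by rewrite big_cons; apply: submodD.
Qed.

Lemma submod_add_line x : submodule (add_line K x).
Proof.
split; first by exists 0; rewrite scale0r subr0; case: subK.
move=> a y z [b Kb] [c Kc]; exists (a * b + c).
have -> : a *: y + z - (a * b + c) *: x = a *: (y - b *: x) + (z - c *: x).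
  by rewrite scalerDl scalerBr scalerA opprD addrACA.
exact: subK.2.
Qed.

Lemma sub_add_line x : K `<=` add_line K x.
Proof. by move=> z Kz; exists 0; rewrite scale0r subr0. Qed.

Lemma mem_add_line x : add_line K x x.
Proof. by exists 1; rewrite scale1r subrr; case: subK. Qed.

Lemma submod_add_multiples a : submodule (add_multiples K a).
Proof.
split; first by exists 0; rewrite scaler0 subr0; case: subK.
move=> b y z [v Kv] [w Kw]; exists (b *: v + w).
have -> : b *: y + z - a *: (b *: v + w) = b *: (y - a *: v) + (z - a *: w).
  by rewrite scalerDr scalerBr opprD addrACA !scalerA mulrC.
exact: subK.2.
Qed.

Lemma sub_add_multiples a : K `<=` add_multiples K a.
Proof. by move=> z Kz; exists 0; rewrite scaler0 subr0. Qed.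

Lemma mem_add_multiples a z : add_multiples K a (a *: z).
Proof. by exists z; rewrite subrr; case: subK. Qed.

End Closure.

Lemma submod_zero : submodule [set 0].
Proof. by split=> // a x y -> ->; rewrite /= scaler0 addr0. Qed.

Lemma submod_span s : submodule (span s).
Proof.
by elim: s => [|x s IHs]; [apply: submod_zero | apply: submod_add_line].
Qed.

Lemma mem_span s x : x \in s -> span s x.
Proof.
elim: s => [//|y s IHs]; rewrite inE => /orP[/eqP-> | /IHs].
  exact/mem_add_line/submod_span.
exact: sub_add_line.
Qed.

Lemma span_sub K s : submodule K -> (forall x, x \in s -> K x) -> span s `<=` K.
Proof.
move=> subK; elim: s => [|x s IHs] Ks z; first by move=> ->; case: subK.
case=> a /IHs Kz; rewrite -[z](subrK (a *: x)).
apply: submodD => //.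
  by apply: Kz => y sy; apply: Ks; rewrite inE sy orbT.
by apply: submodZ => //; apply: Ks; rewrite inE eqxx.
Qed.

Definition fin_gen K : Prop :=
  exists s : seq V, (forall x, x \in s -> K x) /\ K `<=` span s.

Definition noetherian_module : Prop := forall K, submodule K -> fin_gen K.

(** Otherwise one chooses a strictly increasing sequence, whose union is
    finitely generated and so is reached after finitely many steps. *)
Lemma noetherian_max (P : set V -> Prop) :
    noetherian_module -> (exists K, submodule K /\ P K) ->
  exists K, [/\ submodule K, P K &
    forall K', submodule K' -> P K' -> K `<=` K' -> K' `<=` K].
Proof.
move=> noethV [K0 K0P]; apply: contrapT => nomax.
pose T := {K | submodule K /\ P K}.
have step (K : T) : {K' : T | sval K `<=` sval K' /\ ~ (sval K' `<=` sval K)}.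
  apply: cid; case: K => K [subK PK] /=; apply: contrapT => noK'.
  apply: nomax; exists K; split=> // K' subK' PK' leKK'.
  by apply: contrapT => nle; apply: noK'; exists (exist _ K' (conj subK' PK')).
pose f n := iter n (fun U : T => sval (step U)) (exist _ K0 K0P : T).
have fS n : sval (f n) `<=` sval (f n.+1) by case: (svalP (step (f n))).
have f_mono n k : sval (f n) `<=` sval (f (n + k)%N).
  elim: k => [|k IHk]; first by rewrite addn0.
  by rewrite addnS => x /IHk; apply: fS.
have subf n : submodule (sval (f n)) by case: (svalP (f n)).
pose W : set V := [set x | exists n, sval (f n) x].
have subW : submodule W.
  split; first by exists 0; case: (subf 0).
  move=> a x y [k kx] [l ly]; exists (k + l)%N.
  by apply: (subf _).2; [apply: f_mono | rewrite addnC; apply: f_mono].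
have [s [Ws leWs]] := noethV _ subW.
have [n fn] : exists n, forall x, x \in s -> sval (f n) x.
  elim: (s) Ws => [|x r IHr] Wr; first by exists 0.
  have [|n fn] := IHr; first by move=> y ry; apply: Wr; rewrite inE ry orbT.
  have [|k fk] := Wr x; first by rewrite inE eqxx.
  exists (n + k)%N => y; rewrite inE => /orP[/eqP-> | /fn]; last exact: f_mono.
  by rewrite addnC; apply: f_mono.
case: (svalP (step (f n))) => _; apply => x fx.
by apply: span_sub (subf n) fn _ _; apply: leWs; exists n.+1.
Qed.

End Submodules.

Section Colon.
Variables (R : comNzRingType) (V : lmodType R).

Definition colon (K : set V) (z : V) : set R^o := [set a | K ((a : R) *: z)].

Lemma submod_colon K z : submodule K -> submodule (colon K z).
Proof.
move=> subK; split; first by rewrite /colon /= scale0r; case: subK.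
move=> a b c Kb Kc; rewrite /colon /= scalerDl; apply: submodD => //.
by rewrite -scalerA; apply: submodZ.
Qed.

End Colon.

Section Noetherian.
Variables (R : comNzRingType) (Rnoeth : noetherian R).

Lemma noetherian_regular : noetherian_module (R^o : lmodType R).
Proof.
move=> I subI; have [I1 | nI1] := pselect (I 1).
  exists [:: 1]; split=> [x | x _].
    by rewrite inE => /eqP->.
  by exists x; rewrite /= [_ *: _]mulr1 subrr.
have [|n [a Ia]] := Rnoeth (I := I).
  split; rewrite ?unfold_in /=.
  - by apply/asboolP; case: subI.
  - by apply/negP => /asboolP.
  move=> b u v /asboolP Iu /asboolP Iv; apply/asboolP; exact: subI.2.
exists [seq a i | i <- enum 'I_n]; split=> [x /mapP[i _ ->] | x].
  rewrite Ia; exists (fun k => (k == i)%:R).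
  rewrite (bigD1 i) //= eqxx mul1r big1 ?addr0 // => k /negPf->.
  by rewrite mul0r.
rewrite {1}Ia => -[c ->].
apply: (@submod_sum _ R^o) => [|i]; first exact: submod_span.
rewrite -[_ * _]/(c i *: (a i : R^o)).
apply: submodZ; first exact: submod_span.
by apply: mem_span; rewrite map_f ?mem_enum.
Qed.

(** Generators of K come from the span of the later generators and from lifts of
    generators of the ideal of coefficients of the first one. *)
Lemma fin_gen_sub_span (V : lmodType R) (s : seq V) (K : set V) :
  submodule K -> K `<=` span s -> fin_gen K.
Proof.
elim: s K => [|e s IHs] K subK leK; first by exists [::].
have subs := submod_span s.
pose I : set R^o := [set a | exists x, K x /\ span s (x - (a : R) *: e)].
have subI : submodule I.
  split; first by exists 0; rewrite scale0r subr0; case: subK; case: subs.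
  move=> a b c [x [Kx sx]] [y [Ky sy]]; exists (a *: x + y).
  split; first exact: subK.2.
  have -> : a *: x + y - (a *: b + c : R) *: e
          = a *: (x - (b : R) *: e) + (y - (c : R) *: e).
    by rewrite scalerDl scalerBr scalerA opprD addrACA.
  exact: subs.2.
have [bs [Ibs leI]] := noetherian_regular subI.
have [||t [tK leKt]] := IHs (K `&` span s).
- split; first by case: subK; case: subs.
  by move=> a x y [Kx sx] [Ky sy]; split; [apply: subK.2 | apply: subs.2].
- by move=> x [].
have [g gP] : exists g : R -> V,
    forall b, I b -> K (g b) /\ span s (g b - b *: e).
  have /choice[g gP] (b : R) : exists x : V, I b -> K x /\ span s (x - b *: e).
    by have [[x]|] := pselect (I b); [exists x | exists 0].
  by exists g.
exists (map g bs ++ t); split=> [x|z Kz].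
  rewrite mem_cat => /orP[/mapP[b bsb ->] | /tK[]//].
  by case: (gP b (Ibs b bsb)).
have [a sz] := leK z Kz.
have {}leI : span (bs : seq R^o) a by apply: leI; exists z.
elim: bs Ibs a z Kz sz leI => [|b bs IHbs] Ibs a z Kz sz /=.
  by move=> a0; apply: leKt; split=> //; move: sz; rewrite a0 scale0r subr0.
case=> c bsa; have [Kgb sgb] := gP b (Ibs b (mem_head _ _)).
exists c; apply: (IHbs _ (a - c * b)) => //.
- by move=> b' bsb'; apply: Ibs; rewrite inE bsb' orbT.
- by apply: submodB => //; apply: submodZ.
have -> : z - c *: g b - (a - c * b) *: e = (z - a *: e) - c *: (g b - b *: e).
  rewrite scalerBl scalerBr scalerA !opprB addrACA [RHS]addrACA.
  by congr (_ + _); rewrite addrC.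
by apply: submodB => //; apply: submodZ.
Qed.

Lemma fin_gen_noetherian (V : lmodType R) :
  finitely_generated V -> noetherian_module V.
Proof.
case=> n [e genV] K subK; apply: (@fin_gen_sub_span _ (map e (enum 'I_n))) => //.
move=> x _; have [c ->] := genV x; apply: submod_sum => [|i].
  exact: submod_span.
apply: submodZ; first exact: submod_span.
by apply: mem_span; rewrite map_f ?mem_enum.
Qed.

End Noetherian.

Lemma scaleAC (R : comNzRingType) (V : lmodType R) (a b : R) (v : V) :
  a *: (b *: v) = b *: (a *: v).
Proof. by rewrite !scalerA mulrC. Qed.

(** * Local rings and Nakayama's lemma *)

Section Ideals.
Variable R : comNzRingType.
Implicit Types I p : set R^o.

Lemma ideal_mull I (a b : R) : submodule I -> I b -> I (a * b).
Proof. by move=> subI Ib; apply: (submodZ subI a). Qed.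

Lemma ideal_mulr I (a b : R) : submodule I -> I a -> I (a * b).
Proof. by move=> subI Ia; rewrite mulrC; apply: ideal_mull. Qed.

Lemma proper_idealE I : proper_ideal_set I <-> submodule I /\ ~ I 1.
Proof.
split=> [[I0 I1 ID] | [subI I1]].
  split; last by move=> Ione; move: I1; rewrite unfold_in => /asboolP.
  split; first by move: I0; rewrite unfold_in => /asboolP.
  by move=> a x y /asboolP Ix /asboolP Iy; apply/asboolP; apply: ID.
split; rewrite ?unfold_in /=; first by apply/asboolP; case: subI.
  by apply/negP => /asboolP.
by move=> b u v /asboolP Iu /asboolP Iv; apply/asboolP; apply: subI.2.
Qed.

Definition is_prime p : Prop :=
  [/\ submodule p, ~ p 1 & forall a b : R, p (a * b) -> p a \/ p b].

Lemma prime_idealE p : prime_ideal p <-> is_prime p.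
Proof.
split=> [[/proper_idealE[subp p1] pM] | [subp p1 pM]].
  split=> // a b pab; have := pM a b; rewrite !unfold_in => /(_ (asboolT pab)).
  by case/orP => /asboolP; [left | right].
split; first exact/proper_idealE.
by move=> a b; rewrite !unfold_in => /asboolP/pM[] pa; apply/orP;
  [left | right]; apply/asboolP.
Qed.

End Ideals.

Section Local.
Variables (R : comNzRingType) (m : set R).
Hypotheses (Rnoeth : noetherian R) (Rloc : local_ring_with m).

Lemma submod_max : submodule (m : set R^o).
Proof. by case: Rloc => -[/proper_idealE[]]. Qed.

Lemma max_neq1 : ~ m 1.
Proof. by case: Rloc => -[/proper_idealE[]]. Qed.

Lemma proper_sub_max (I : set R^o) : submodule I -> ~ I 1 -> I `<=` m.
Proof.
move=> subI I1.
have [|J [subJ [J1 IJ] Jmax]] := @noetherian_max _ R^o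
    (fun J => ~ J 1 /\ I `<=` J) (noetherian_regular Rnoeth).
  by exists I; split=> //; split.
suff -> : m = J by [].
symmetry; apply: (Rloc.2); split; first exact/proper_idealE.
move=> J' /proper_idealE[subJ' J'1] JJ'; apply/seteqP; split=> //.
by apply: Jmax => //; split=> //; apply: subset_trans IJ JJ'.
Qed.

Lemma not_max_unit (a : R) : ~ m a -> exists b, a * b = 1.
Proof.
move=> ma; apply: contrapT => nunit; apply: ma.
pose I : set R^o := [set b | exists c, b = a * c].
have subI : submodule I.
  split; first by exists 0; rewrite mulr0.
  by move=> b _ _ [c ->] [d ->]; exists (b * c + d); rewrite mulrDr mulrCA.
have Ia : I a by exists 1; rewrite mulr1.
by apply: (proper_sub_max subI _ Ia) => -[b ab1]; apply: nunit; exists b.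
Qed.

Lemma max_prime : is_prime (m : set R^o).
Proof.
split=> [||a b mab]; [exact: submod_max | exact: max_neq1 |].
apply: contrapT => /not_orP[/not_max_unit[c ac1] mb]; apply: mb.
rewrite -[b]mul1r -ac1 mulrAC; exact: ideal_mulr submod_max mab.
Qed.

Lemma max_unit_sub (a b : R) : m a -> exists c, (1 - a * b) * c = 1.
Proof.
move=> ma; apply: not_max_unit => m1ab; apply: max_neq1.
rewrite -(subrK (a * b) 1); apply: (submodD submod_max) => //.
exact: ideal_mulr submod_max ma.
Qed.

Variable V : lmodType R.
Hypothesis Vnoeth : noetherian_module V.

(** If U were not inside K, take V maximal among the submodules that contain K
    but not U; for u in U outside V, V + Ru contains U, and u = k + x w then
    becomes an equation for u over V with a unit coefficient. *)
Lemma nakayama (K U : set V) (x : R) :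
    submodule K -> m x ->
    (forall u, U u -> exists2 w, U w & K (u - x *: w)) ->
  U `<=` K.
Proof.
move=> subK mx UxU; apply: contrapT => nUK.
have [|W [subW [KW nUW] Wmax]] :=
    @noetherian_max _ V (fun W => K `<=` W /\ ~ (U `<=` W)) Vnoeth.
  by exists K; split=> //; split.
have [u Uu nWu] : exists2 u, U u & ~ W u.
  apply: contrapT => noU; apply: nUW => u Uu; apply: contrapT => nWu.
  by apply: noU; exists u.
have UWu : U `<=` add_line W u.
  apply: contrapT => nU; apply: nWu.
  apply: (Wmax (add_line W u)); first exact: submod_add_line.
  - by split=> //; apply: subset_trans KW (sub_add_line _).
  - exact: sub_add_line.
  - exact: mem_add_line.
have [w Uw Kuw] := UxU u Uu; have [a Wwa] := UWu w Uw.
have [c c1] := max_unit_sub a mx; apply: nWu.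
rewrite -[u]scale1r -c1 [_ * c]mulrC -scalerA; apply: submodZ => //.
have -> : (1 - x * a) *: u = (u - x *: w) + x *: (w - a *: u).
  by rewrite scalerBl scale1r -scalerA scalerBr addrA subrK.
by apply: submodD => //; [apply: KW | apply: submodZ].
Qed.

End Local.

(** * Associated primes *)

Section Associated.
Variables (R : comNzRingType) (V : lmodType R).
Hypotheses (Rnoeth : noetherian R) (Vnoeth : noetherian_module V).
Implicit Types K : set V.

(** A maximal annihilator of a multiple of z is prime. *)
Lemma exists_associated_prime K (z : V) : submodule K -> ~ K z ->
  exists a : R, is_prime (colon K (a *: z)).
Proof.
move=> subK nKz.
have [|p [subp [a nKa ->] pmax]] := @noetherian_max _ R^o
    (fun p => exists2 a : R, ~ K (a *: z) & p = colon K (a *: z))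
    (noetherian_regular Rnoeth).
  exists (colon K (1 *: z)); split; first exact: submod_colon.
  by exists 1 => //; rewrite scale1r.
exists a; split; first exact: submod_colon.
  by rewrite /colon /= scale1r.
move=> b c; rewrite /colon /= -scalerA => Kbc.
have [Kc | nKc] := pselect (K (c *: (a *: z))); first by right.
left; apply: (pmax (colon K (c *: (a *: z)))) => //.
- exact: submod_colon.
- by exists (c * a) => //; rewrite -?scalerA.
by move=> d; rewrite /colon /= => Kd; rewrite scaleAC; apply: submodZ.
Qed.

(** For z outside K with prime annihilator p modulo K, an associated prime of
    V/K is p or an associated prime of V/(K + Rz); this gives an induction on K,
    from larger submodules to smaller ones. *)
Lemma finitely_many_associated K : submodule K ->
  exists ps : seq (set R^o), forall z, is_prime (colon K z) -> colon K z \in ps.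
Proof.
move=> subK; apply: contrapT => noK.
have [|J [subJ noJ Jmax]] := @noetherian_max _ V (fun K => ~ exists
    ps : seq (set R^o), forall z, is_prime (colon K z) -> colon K z \in ps)
  Vnoeth.
  by exists K.
have [z nJz] : exists z, ~ J z.
  apply: contrapT => noz; apply: noJ; exists [::] => z [_ nJ1 _].
  by case: nJ1; apply: contrapT => nJz; apply: noz; exists (1 *: z).
have [a pr_p] := exists_associated_prime subJ nJz.
set y := a *: z in pr_p; have subJ' := submod_add_line subJ y.
have [ps psP] : exists ps : seq (set R^o), forall z,
    is_prime (colon (add_line J y) z) -> colon (add_line J y) z \in ps.
  apply: contrapT => noJ'; have [_ nJ1 _] := pr_p; apply: nJ1.
  rewrite /colon /= scale1r; apply: (Jmax (add_line J y)) => //.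
    exact: sub_add_line.
  exact: mem_add_line.
apply: noJ; exists (colon J y :: ps) => w pr_q; rewrite inE.
have [[b [J'b nJb]] | nob] :=
    pselect (exists b : R, add_line J y (b *: w) /\ ~ J (b *: w)).
  have [c Jbc] := J'b; apply/orP; left; apply/eqP.
  have [_ _ qM] := pr_q; have [_ _ pM] := pr_p.
  have npc : ~ colon J y c.
    move=> Jc; apply: nJb; rewrite -(subrK (c *: y) (b *: w)).
    exact: submodD.
  have JE d : J (d *: (b *: w)) <-> J (d *: (c *: y)).
    have Jd : J (d *: (b *: w) - d *: (c *: y)).
      by rewrite -scalerBr; apply: submodZ.
    split=> Jx; last by rewrite -(subrK (d *: (c *: y)) (_ *: _)); apply: submodD.
    by rewrite -[d *: (c *: y)](subKr (d *: (b *: w))); apply: submodB.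
  apply/seteqP; split=> d; rewrite /colon /= => Jd.
    have: J ((d * c) *: y).
      by rewrite -scalerA; apply/JE; rewrite scaleAC; apply: submodZ.
    by move/pM; case.
  have: J ((d * b) *: w).
    by rewrite -scalerA; apply/JE; rewrite scaleAC; apply: submodZ.
  by move/qM; case.
have eqJ : colon (add_line J y) w = colon J w.
  apply/seteqP; split=> d; last by move=> Jd; apply: (sub_add_line y Jd).
  by move=> J'd; apply: contrapT => nJd; apply: nob; exists d.
by rewrite -eqJ; apply/orP; right; apply: psP; rewrite eqJ.
Qed.

Definition nonzerodivisor K (r : R) : Prop := forall z, K (r *: z) -> K z.

Lemma nonzerodivisor_primes K : submodule K ->
  exists2 ps : seq (set R^o), (forall p, p \in ps -> is_prime p) &
    forall r, nonzerodivisor K r <-> forall p, p \in ps -> ~ p r.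
Proof.
move=> subK; have [ps psP] := finitely_many_associated subK.
exists [seq p <- ps | `[< is_prime p /\ exists z, p = colon K z >]].
  by move=> p; rewrite mem_filter => /andP[/asboolP[]].
move=> r; split=> [rK p | avoid z Krz].
  rewrite mem_filter => /andP[/asboolP[[_ p1 _] [z pE]] _] pr.
  by apply: p1; move: pr; rewrite pE /colon /= scale1r; apply: rK.
apply: contrapT => nKz; have [a pr_p] := exists_associated_prime subK nKz.
apply: (avoid (colon K (a *: z))).
  rewrite mem_filter psP // andbT; apply/asboolP; split=> //.
  by exists (a *: z).
by rewrite /colon /= scaleAC; apply: submodZ.
Qed.

End Associated.

(** * Regular sequences *)

Section Regular.
Variables (R : comNzRingType) (m : set R).
Hypotheses (Rnoeth : noetherian R) (Rloc : local_ring_with m).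

(** Two powers y^k and y^l cannot both bring x into the same prime p, for then
    p would contain y, as 1 - y^(l-k) is a unit, and hence x. *)
Lemma avoid_primes_add (ps qs : seq (set R^o)) (x y : R) :
    (forall p, p \in ps ++ qs -> is_prime p) -> m x -> m y ->
    (forall p, p \in ps -> ~ p x) -> (forall p, p \in qs -> ~ p y) ->
  exists2 z, m z & forall p, p \in ps ++ qs -> ~ p z.
Proof.
move=> pr_ps mx my psx qsy.
have rsxy p : p \in ps ++ qs -> ~ (p x /\ p y).
  by rewrite mem_cat => /orP[/psx | /qsy] np [].
have [k0 k0P] : exists k0, forall p, p \in ps ++ qs ->
    forall k, (k0 <= k)%N -> ~ p (x + y ^+ k.+1).
  elim: (ps ++ qs) pr_ps rsxy => [|p rs IHrs] pr_rs rsxy; first by exists 0.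
  have [q rsq|q rsq|k0 k0P] := IHrs.
  - by apply: pr_rs; rewrite inE rsq orbT.
  - by apply: rsxy; rewrite inE rsq orbT.
  have [subp p1 pM] := pr_rs p (mem_head _ _).
  have nxy := rsxy p (mem_head _ _).
  have p_pow k : p (y ^+ k.+1) -> p y.
    by elim: k => [//|k IHk]; rewrite exprS => /pM[].
  have uniq_k k l : (k < l)%N -> p (x + y ^+ k.+1) -> ~ p (x + y ^+ l.+1).
    move=> ltkl pk pl; have py : p y.
      have: p (y ^+ k.+1 * (1 - y * y ^+ (l - k).-1)).
        rewrite mulrBr mulr1 -exprS prednK ?subn_gt0 // -exprD addSn.
        rewrite subnKC ?(ltnW ltkl) //.
        have -> : y ^+ k.+1 - y ^+ l.+1 = (x + y ^+ k.+1) - (x + y ^+ l.+1).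
          by rewrite opprD addrACA subrr add0r.
        exact: (submodB subp).
      move/pM => -[/p_pow // | p1y].
      have [c c1] := max_unit_sub Rnoeth Rloc (y ^+ (l - k).-1) my.
      by case: p1; rewrite -c1; apply: ideal_mulr.
    apply: nxy; split=> //; rewrite -(addrK (y ^+ k.+1) x).
    by apply: (submodB subp) => //; rewrite exprS; apply: ideal_mulr.
  have [[k [lek pk]] | nok] :=
      pselect (exists k, (k0 <= k)%N /\ p (x + y ^+ k.+1)).
    exists k.+1 => q; rewrite inE => /orP[/eqP-> l ltkl | rsq l ltkl].
      exact: uniq_k pk.
    by apply: (k0P q rsq); rewrite (leq_trans lek) // ltnW.
  exists k0 => q; rewrite inE => /orP[/eqP-> l lel pl | rsq l]; last exact: k0P.
  by apply: nok; exists l.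
exists (x + y ^+ k0.+1) => [|p psp]; last exact: k0P.
apply: (submodD (submod_max Rloc)) => //.
by rewrite exprS; apply: ideal_mulr (submod_max Rloc) my.
Qed.

Lemma common_nonzerodivisor n (V : nat -> lmodType R) (K : forall i, set (V i)) :
    (forall i, (i < n)%N -> [/\ noetherian_module (V i), submodule (K i) &
       exists2 x, m x & nonzerodivisor (K i) x]) ->
  exists2 x, m x & forall i, (i < n)%N -> nonzerodivisor (K i) x.
Proof.
move=> VK.
suff [ps [pr_ps [x mx psx] psP]] : exists ps : seq (set R^o),
    [/\ forall p, p \in ps -> is_prime p,
        exists2 x, m x & forall p, p \in ps -> ~ p x &
        forall r, (forall p, p \in ps -> ~ p r) ->
          forall i, (i < n)%N -> nonzerodivisor (K i) r].
  by exists x => //; apply: psP.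
elim: n VK => [|n IHn] VK.
  by exists [::]; split=> //; exists 0 => //; case: (submod_max Rloc).
have [i ltin|ps [pr_ps [x mx psx] psP]] := IHn; first by apply: VK; apply: ltnW.
have [Vn subK [y my Ky]] := VK n (ltnSn n).
have [qs pr_qs qsP] := nonzerodivisor_primes Rnoeth Vn subK.
have pr_pqs p : p \in ps ++ qs -> is_prime p.
  by rewrite mem_cat => /orP[/pr_ps | /pr_qs].
exists (ps ++ qs); split=> //.
  by apply: avoid_primes_add mx my psx _ => //; apply/qsP.
move=> r rP i; rewrite ltnS leq_eqVlt => /orP[/eqP-> | ltin].
  by apply/qsP => q qsq; apply: rP; rewrite mem_cat qsq orbT.
by apply: psP => // p psp; apply: rP; rewrite mem_cat psp.
Qed.

Section Sequence.
Variable V : lmodType R.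
Implicit Types (K : set V) (xs : seq R).

(** K + (xs)V. *)
Definition mul_seq K xs : set V := foldl (@add_multiples R V) K xs.

(** A weakly regular sequence on V/K. *)
Fixpoint regular_mod K xs : Prop :=
  if xs is x :: xs' then
    nonzerodivisor K x /\ regular_mod (add_multiples K x) xs'
  else True.

Lemma submod_mul_seq K xs : submodule K -> submodule (mul_seq K xs).
Proof.
elim: xs K => [//|x xs IHxs] K subK; apply: IHxs.
exact: submod_add_multiples.
Qed.

Lemma sub_mul_seq K xs : K `<=` mul_seq K xs.
Proof.
elim: xs K => [|x xs IHxs] K z Kz //; apply: IHxs; exact: sub_add_multiples.
Qed.

Lemma mul_seqP K xs z :
  mul_seq K xs z <->
  exists c : 'I_(size xs) -> V, K (z - \sum_(i < size xs) xs`_i *: c i).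
Proof.
elim: xs K z => [|x xs IHxs] K z /=.
  split=> [Kz | [c]]; last by rewrite big_ord0 subr0.
  by exists (fun=> 0); rewrite big_ord0 subr0.
split=> [/IHxs[c [w Kw]] | [c Kc]].
  exists (fun i => if unlift ord0 i is Some k then c k else w).
  rewrite big_ord_recl unlift_none opprD addrA addrAC.
  under eq_bigr do rewrite liftK; exact: Kw.
apply/IHxs; exists (fun i => c (lift ord0 i)); exists (c ord0).
by move: Kc; rewrite big_ord_recl opprD addrA addrAC.
Qed.

Lemma seq_mul_moduleE xs : @seq_mul_module R xs V = mul_seq [set 0] xs.
Proof.
apply/seteqP; split=> z; rewrite mul_seqP => -[c].
  by move->; exists c; rewrite /= subrr.
by move=> /= /eqP; rewrite subr_eq0 => /eqP->; exists c.
Qed.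

Lemma regular_sequence_mod xs : regular_sequence xs V -> regular_mod [set 0] xs.
Proof.
case=> _ reg.
have {reg}: forall i, (i < size xs)%N -> forall z : V,
    mul_seq [set 0] (take i xs) (xs`_i *: z) -> mul_seq [set 0] (take i xs) z.
  by move=> i lti z; rewrite -seq_mul_moduleE; apply: reg.
elim: xs [set 0] => [//|x xs IHxs] K xsK; split; first exact: (xsK 0).
by apply: IHxs => i lti z; apply: (xsK i.+1).
Qed.

Lemma regular_mod_rcons K xs x :
  regular_mod K (rcons xs x) <->
  regular_mod K xs /\ nonzerodivisor (mul_seq K xs) x.
Proof.
elim: xs K => [|y xs IHxs] K /=; first by tauto.
by rewrite IHxs; tauto.
Qed.

Lemma add_multiplesC K x y :
  add_multiples (add_multiples K x) y = add_multiples (add_multiples K y) x.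
Proof.
by apply/seteqP; split=> z [v [w Kw]]; exists w; exists v; rewrite addrAC.
Qed.

Hypothesis Vnoeth : noetherian_module V.

(** The submodule (K : y)/K of V/K equals x times itself, so it is zero by
    Nakayama's lemma. *)
Lemma regular_swap K x y : submodule K -> m x ->
    nonzerodivisor K x -> nonzerodivisor (add_multiples K x) y ->
  nonzerodivisor K y /\ nonzerodivisor (add_multiples K y) x.
Proof.
move=> subK mx xK yK; split=> z.
  apply: (@nakayama _ _ Rnoeth Rloc _ Vnoeth K (fun z => K (y *: z)) x) => //.
  move=> u Kyu; have [w Kuw] := yK u (sub_add_multiples x Kyu).
  exists w => //; apply: xK; rewrite scaleAC.
  rewrite -(subKr (y *: u) (y *: (x *: w))).
  by apply: submodB => //; rewrite -scalerBr; apply: submodZ.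
case=> v Kv; have [v' Kv'] : add_multiples K x v.
  apply: yK; exists z; rewrite -opprB; exact: submodN.
exists v'; apply: xK; rewrite scalerBr scaleAC.
have -> : x *: z - y *: (x *: v') = (x *: z - y *: v) + y *: (v - x *: v').
  by rewrite scalerBr addrA subrK.
by apply: submodD => //; apply: submodZ.
Qed.

Lemma regular_to_front K xs z : submodule K -> (forall x, x \in xs -> m x) ->
  regular_mod K (rcons xs z) -> regular_mod K (z :: xs).
Proof.
elim: xs K => [//|x xs IHxs] K subK mxs [xK /IHxs reg].
have [||zKx regxs] := reg.
- exact: submod_add_multiples.
- by move=> y xsy; apply: mxs; rewrite inE xsy orbT.
have [|zK xKz] := regular_swap subK _ xK zKx; first exact/mxs/mem_head.
by do 2!split=> //; rewrite add_multiplesC.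
Qed.

End Sequence.

(** Modules with regular sequences of the same length have a common one: the
    last terms may be replaced by one element, which then moves to the front. *)
Lemma common_regular n (V : nat -> lmodType R) d (K : forall i, set (V i)) :
    (forall i, (i < n)%N -> [/\ noetherian_module (V i), submodule (K i) &
       exists xs, [/\ forall x, x \in xs -> m x, size xs = d &
         regular_mod (K i) xs]]) ->
  exists xs, [/\ forall x, x \in xs -> m x, size xs = d &
    forall i, (i < n)%N -> regular_mod (K i) xs].
Proof.
elim: d K => [|d IHd] K VK; first by exists [::].
have /choice[xs xsP] (i : nat) : exists xs, (i < n)%N ->
    [/\ forall x, x \in xs -> m x, size xs = d, regular_mod (K i) xs &
       exists2 x, m x & nonzerodivisor (mul_seq (K i) xs) x].
  have [ltin | _] := ltnP i n; last by exists [::].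
  have [_ _ [ys [mys]]] := VK i ltin.
  case/lastP: ys mys => [//|ys y] mys; rewrite size_rcons => -[szys].
  move=> /regular_mod_rcons[regys yK]; exists ys => _; split=> //.
    by move=> x ysx; apply: mys; rewrite mem_rcons inE ysx orbT.
  by exists y => //; apply: mys; rewrite mem_rcons mem_head.
have [i ltin|z mz zK] :=
    @common_nonzerodivisor n V (fun i => mul_seq (K i) (xs i)).
  have [Vi subKi _] := VK i ltin; have [_ _ _ xK] := xsP i ltin.
  by split=> //; apply: submod_mul_seq.
have zxsK i : (i < n)%N -> regular_mod (K i) (z :: xs i).
  move=> ltin; have [Vi subKi _] := VK i ltin.
  have [mxs _ regxs _] := xsP i ltin; apply: regular_to_front => //.
  by apply/regular_mod_rcons; split=> //; apply: zK.
have [i ltin|ys [mys szys ysK]] := IHd (fun i => add_multiples (K i) z).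
  have [Vi subKi _] := VK i ltin; have [mxs szxs _ _] := xsP i ltin.
  split=> //; first exact: submod_add_multiples.
  by exists (xs i); split=> //; case: (zxsK i ltin).
exists (z :: ys); split=> [x||i ltin] /=; last 1 first.
- by split; [case: (zxsK i ltin) | apply: ysK].
- by rewrite inE => /orP[/eqP-> | /mys].
- by rewrite szys.
Qed.

End Regular.

(** * Systems of parameters *)

Section Dimension.
Variable R : comNzRingType.
Hypothesis Rnoeth : noetherian R.

(** The prime q is maximal among the ideals containing K that miss the
    multiplicative set of all a x^n with a outside p. *)
Lemma exists_smaller_prime (K p : set R^o) (x : R) :
    submodule K -> nonzerodivisor K x -> is_prime p -> K `<=` p ->
  exists q : set R^o, [/\ is_prime q, K `<=` q, q `<=` p & ~ q x].
Proof.
move=> subK xK [subp p1 pM] Kp.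
have [|q [subq [Kq qP] qmax]] := @noetherian_max _ R^o (fun I =>
    K `<=` I /\ forall (a : R) n, ~ p a -> ~ I (a * x ^+ n))
    (noetherian_regular Rnoeth).
  exists K; split=> //; split=> // a n npa Kax; apply/npa/Kp.
  elim: n Kax => [|n IHn] Kax; first by rewrite mulr1 in Kax.
  by apply/IHn/xK; rewrite /= exprS mulrCA in Kax.
have q1 : ~ q 1 by have := qP 1 0%N p1; rewrite mulr1.
have meet (b : R) : ~ q b -> exists (a : R) n (c : R),
    [/\ ~ p a & q (a * x ^+ n - c * b)].
  move=> nqb; apply: contrapT => noa; apply/nqb/(qmax (add_line q b)).
  - exact: submod_add_line.
  - split; first exact: subset_trans (@sub_add_line _ _ q b).
    by move=> a n npa [c qc]; apply: noa; exists a, n, c.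
  - exact: sub_add_line.
  exact: mem_add_line.
exists q; split=> //.
- split=> // b c qbc; apply: contrapT => /not_orP[/meet[a [n [d [npa qa]]]]].
  case/meet=> a' [n' [d' [npa' qa']]].
  apply: (qP (a * a') (n + n')%N); first by case/pM.
  have -> : a * a' * x ^+ (n + n') = (a * x ^+ n - d * b) * (a' * x ^+ n')
      + d * b * (a' * x ^+ n' - d' * c) + d * d' * (b * c).
    by rewrite exprD; ring.
  apply: (submodD subq); last exact: (ideal_mull (d * d') subq qbc).
  apply: (submodD subq); first exact: (ideal_mulr (a' * x ^+ n') subq qa).
  exact: (ideal_mull (d * b) subq qa').
- by move=> b qb; apply: contrapT => npb; apply: (qP b 0%N npb); rewrite mulr1.
by move=> qx; apply: (qP 1 1%N p1); rewrite mul1r.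
Qed.

(** Going down the sequence, p loses one element x at each step, as x is a
    nonzerodivisor modulo the ideal of the elements before it. *)
Lemma prime_chain_below (K p : set R^o) (xs : seq R) :
    submodule K -> regular_mod (V := R^o) K xs ->
    is_prime p -> mul_seq K xs `<=` p ->
  exists q : nat -> set R,
    [/\ q (size xs) = p, K `<=` q 0%N & prime_chain (size xs) q].
Proof.
elim: xs K => [|x xs IHxs] K subK /=.
  move=> _ pr_p Kp; exists (fun=> p); split=> //; split=> // i _.
  exact/prime_idealE.
case=> xK regxs pr_p Kp.
have [q [qp Kq [pr_q q_lt]]] :=
  IHxs _ (submod_add_multiples subK x) regxs pr_p Kp.
have Kq0 : K `<=` q 0%N.
  by move=> z Kz; apply: Kq; exact: (@sub_add_multiples _ R^o K x).
have pr_q0 : is_prime (q 0%N : set R^o) by apply/prime_idealE; apply: pr_q.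
have [q' [pr_q' Kq' q'q nq'x]] := exists_smaller_prime subK xK pr_q0 Kq0.
exists (fun i => if i is k.+1 then q k else q'); split=> //.
split=> [[|i] lei | [|i] lti]; [exact/prime_idealE | exact: pr_q | | exact: q_lt].
split=> // qq'; apply/nq'x/qq'/Kq.
by have := mem_add_multiples (V := R^o) subK x 1; rewrite [_ *: _]mulr1.
Qed.

Variable m : set R.
Hypothesis Rloc : local_ring_with m.
Variables (d : nat) (xs : seq R).
Hypotheses (dimR : krull_dim_eq R d) (size_xs : size xs = d).
Hypotheses (mxs : forall x, x \in xs -> m x).
Hypothesis regxs : regular_mod (V := R^o) [set 0] xs.

Let X : set R^o := mul_seq (V := R^o) [set 0] xs.

Lemma submod_params : submodule X.
Proof. exact/submod_mul_seq/submod_zero. Qed.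

(** A prime over X other than m has a chain of d primes strictly below it, so
    that m would be the top of a chain of length d + 1. *)
Lemma prime_over_params (p : set R^o) : is_prime p -> X `<=` p -> p = m.
Proof.
move=> pr_p Xp; have [subp p1 _] := pr_p.
have pm := proper_sub_max Rnoeth Rloc subp p1.
apply: contrapT => npm.
have [q [qp _ [pr_q q_lt]]] := prime_chain_below (submod_zero _) regxs pr_p Xp.
have: (d.+1 <= d)%N; last by rewrite ltnn.
apply: (dimR.2 _ (fun i => if (i <= d)%N then q i else m)); split=> i.
  move=> _; have [lei | _] := leqP i d; first by apply: pr_q; rewrite size_xs.
  exact/prime_idealE/(max_prime Rnoeth Rloc).
move=> lei; have [-> | lti] : i = d \/ (i < d)%N.
    by apply/predU1P; rewrite -leq_eqVlt.
  rewrite leqnn ltnn -size_xs qp; split=> // mp; apply: npm.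
  by apply/seteqP; split.
by rewrite lti (ltnW lti); apply: q_lt; rewrite size_xs.
Qed.

(** An associated prime of V/K contains X, so it is m. *)
Lemma exists_socle (V : lmodType R) (K : set V) (z : V) :
    submodule K -> (forall a, X a -> K (a *: z)) -> ~ K z ->
  exists a : R, ~ K (a *: z) /\ forall r : R, K (r *: (a *: z)) <-> m r.
Proof.
move=> subK XK nKz; have [a pr_p] := exists_associated_prime Rnoeth subK nKz.
have pE : colon K (a *: z) = m.
  apply: prime_over_params => // b Xb; rewrite /colon /= scaleAC.
  by apply: submodZ => //; apply: XK.
exists a; split=> [Kaz | r]; last by rewrite -pE.
by case: pr_p => _ p1 _; apply: p1; rewrite /colon /= scale1r.
Qed.

Lemma mul_seq_proper (V : lmodType R) (K : set V) (ys : seq R) :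
    noetherian_module V -> submodule K -> (forall y, y \in ys -> m y) ->
  (exists z, ~ K z) -> exists z, ~ mul_seq K ys z.
Proof.
move=> Vnoeth; elim: ys K => [//|y ys IHys] K subK mys [z nKz].
apply: IHys; first exact: submod_add_multiples.
  by move=> y' ysy'; apply: mys; rewrite inE ysy' orbT.
apply: contrapT => noz; apply: nKz.
have my : m y by apply: mys; rewrite mem_head.
apply: (nakayama Rnoeth Rloc Vnoeth (U := setT) subK my) => // u _.
have [w Kuw] : add_multiples K y u.
  by apply: contrapT => nu; apply: noz; exists u.
by exists w.
Qed.

End Dimension.

(** * Regular sequences on syzygies *)

Section ShortExact.
Variables (R : comNzRingType) (A B C : lmodType R).
Variables (f : {linear A -> B}) (p : {linear B -> C}).
Hypotheses (f_inj : injective f) (p_surj : forall c, exists b, p b = c).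
Hypothesis exact_fp : forall b, p b = 0 -> exists a, b = f a.
Hypothesis pf0 : forall a, p (f a) = 0.

(** If f a = x b modulo KB, then x kills p b in C/KC, so b may be corrected by
    an element of KB to lie in the image of A. The sets KA, KB and KC are the
    multiples of the earlier terms of the sequence. *)
Lemma regular_kernel_mod (KA : set A) (KB : set B) (KC : set C) (xs : seq R) :
    submodule KA -> submodule KB -> submodule KC ->
    (forall a, KA a <-> KB (f a)) -> (forall b, KB b -> KC (p b)) ->
    (forall b, KC (p b) -> exists2 b', KB b' & p b = p b') ->
    regular_mod KC xs ->
  (forall a, mul_seq KB xs (f a) -> mul_seq KA xs a) /\
  (regular_mod KB xs -> regular_mod KA xs).
Proof.
elim: xs KA KB KC => [|x xs IHxs] KA KB KC subA subB subC KAB KBC KCB /=.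
  by move=> _; split=> // a /KAB.
case=> xC regC.
have [||||b [w Kb]|b [c Kc]|mulA regA] := IHxs (add_multiples KA x)
    (add_multiples KB x) (add_multiples KC x) _ _ _ _ _ _ regC.
- exact: submod_add_multiples.
- exact: submod_add_multiples.
- exact: submod_add_multiples.
- move=> a; split=> [[a' /KAB Ka] | [b Kb]].
    by exists (f a'); rewrite linearB linearZ in Ka.
  have /xC/KCB[b' Kb' pbb'] : KC (x *: p b).
    have := KBC _ Kb; rewrite linearB pf0 sub0r linearZ => /(submodN subC).
    by rewrite opprK.
  have [|a' bE] := exact_fp (b := b - b'); first by rewrite linearB pbb' subrr.
  exists a'; apply/KAB; rewrite linearB linearZ -bE.
  have -> : f a - x *: (b - b') = (f a - x *: b) + x *: b'.
    by rewrite scalerBr opprB addrA addrAC.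
  by apply: submodD => //; apply: submodZ.
- by exists (p w); have := KBC _ Kb; rewrite linearB linearZ.
- have [w pw] := p_surj c; rewrite -pw -linearZ -linearB in Kc.
  have [b' Kb' pb'] := KCB _ Kc; exists (b' + x *: w).
    by exists w; rewrite addrK.
  by rewrite linearD -pb' linearB subrK.
split=> // -[xB /regA]; split=> // a KAxa; apply/KAB/xB.
by rewrite -linearZ; apply/KAB.
Qed.

(** If xs is regular on C, then Tor_1(R/(xs), C) = 0. *)
Lemma regular_kernel (xs : seq R) : regular_mod (V := C) [set 0] xs ->
  (forall a, mul_seq [set 0] xs (f a) -> mul_seq [set 0] xs a) /\
  (regular_mod (V := B) [set 0] xs -> regular_mod (V := A) [set 0] xs).
Proof.
apply: regular_kernel_mod; try exact: submod_zero.
- move=> a; split=> /= [-> | fa0]; first exact: linear0.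
  by apply: f_inj; rewrite linear0.
- by move=> b ->; apply: linear0.
by move=> b /= pb0; exists 0; rewrite ?linear0.
Qed.

End ShortExact.

Section Rows.
Variables (R : comNzRingType) (n : nat).

Definition rows_in (K : set R^o) : set 'rV[R]_n := [set v | forall i, K (v 0 i)].

Lemma rows_in0 : rows_in [set 0] = [set 0].
Proof.
apply/seteqP; split=> v; last by move=> -> i; rewrite /= mxE.
by move=> v0; apply/rowP => i; rewrite mxE; apply: v0.
Qed.

Lemma rows_in_mul_seq K xs : rows_in (mul_seq K xs) = mul_seq (rows_in K) xs.
Proof.
elim: xs K => [//|x xs IHxs] K /=; rewrite IHxs; congr mul_seq.
apply/seteqP; split=> v.
  move=> vK; have /choice[w wP] i : exists w : R, K (v 0 i - x * w).
    by case: (vK i) => w; exists w.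
  by exists (\row_i w i) => i; rewrite !mxE.
by case=> w Kw i; exists (w 0 i); have := Kw i; rewrite !mxE.
Qed.

Lemma regular_rows K xs :
  regular_mod (V := R^o) K xs -> regular_mod (rows_in K) xs.
Proof.
elim: xs K => [//|x xs IHxs] K [xK /IHxs].
have -> : rows_in (add_multiples K x) = add_multiples (rows_in K) x.
  exact: rows_in_mul_seq K [:: x].
by split=> // v Kxv i; apply: xK; have := Kxv i; rewrite mxE.
Qed.

End Rows.

Section Corestriction.
Variables (R : comNzRingType) (U V : lmodType R) (f : {linear U -> V}).

Lemma linear_image_mem u : f u \in linear_image f.
Proof. by rewrite unfold_in; apply/asboolP; exists u. Qed.

Definition corestrict u : image_module f := ImageModule (linear_image_mem u).

Lemma corestrict_is_linear : linear corestrict.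
Proof. by move=> a u v; apply: val_inj; rewrite /= linearP. Qed.

HB.instance Definition _ :=
  GRing.isLinear.Build R U (image_module f) *:%R corestrict corestrict_is_linear.

Lemma corestrict_surj y : exists u, corestrict u = y.
Proof.
have := image_valP y; rewrite unfold_in => /asboolP[u yu].
by exists u; apply: val_inj.
Qed.

Lemma corestrict_eq0 u : corestrict u = 0 -> f u = 0.
Proof. by move/(congr1 val). Qed.

End Corestriction.

Section Syzygies.
Variables (R : comNzRingType) (M : lmodType R) (F : free_resolution M).
Variable xs : seq R.
Hypothesis regR : regular_mod (V := R^o) [set 0] xs.
Hypothesis regM : regular_mod (V := M) [set 0] xs.

Let inclusion n : {linear syzygy F n.+1 -> 'rV[R]_(fr_rank F n)} :=
  [the {linear image_module (fr_diff F n) -> 'rV[R]_(fr_rank F n)} of \val].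

Lemma regular_syzygy_step n :
    regular_mod (V := syzygy F n) [set 0] xs ->
  (forall a : syzygy F n.+1,
     mul_seq [set 0] xs (inclusion n a) -> mul_seq [set 0] xs a) /\
  regular_mod (V := syzygy F n.+1) [set 0] xs.
Proof.
have regF : regular_mod (V := 'rV[R]_(fr_rank F n)) [set 0] xs.
  by rewrite -rows_in0; apply: regular_rows.
have incl_inj : injective (inclusion n) by apply: val_inj.
have inclP v : (exists w, v = fr_diff F n w) -> exists a, v = inclusion n a.
  by case=> w ->; exists (corestrict (fr_diff F n) w).
have incl_diff a : exists w, inclusion n a = fr_diff F n w.
  by have := image_valP a; rewrite unfold_in => /asboolP.
case: n => [|n] in regF incl_inj inclP incl_diff *.
  move=> /(regular_kernel (p := fr_aug F) incl_inj)[|||mulA regA].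
  - exact: fr_surj.
  - by move=> b /fr_exact0; apply: inclP.
  - by move=> a; apply/fr_exact0; apply: incl_diff.
  by split=> //; apply: regA.
move=> /(regular_kernel (p := corestrict (fr_diff F n)) incl_inj).
case=> [|||mulA regA].
- exact: corestrict_surj.
- by move=> b /corestrict_eq0/fr_exact; apply: inclP.
- by move=> a; apply: val_inj; apply/fr_exact; apply: incl_diff.
by split=> //; apply: regA.
Qed.

Lemma regular_syzygy n : regular_mod (V := syzygy F n) [set 0] xs.
Proof. by elim: n => [//|n /regular_syzygy_step[]]. Qed.

Variables (m : set R) (s : R).
Hypothesis Fmin : minimal_resolution m F.
Hypothesis s_socle : forall r : R, m r -> mul_seq (V := R^o) [set 0] xs (r * s).

(** The n-th syzygy lies in m F_(n-1), so that s maps it into (xs) F_(n-1),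
    whose intersection with the syzygy is (xs) times the syzygy. *)
Lemma socle_mul_syzygy n (a : syzygy F n) :
  (0 < n)%N -> mul_seq [set 0] xs (s *: a).
Proof.
case: n a => [//|n] a _.
have [mulA _] := regular_syzygy_step (regular_syzygy n); apply: mulA.
rewrite linearZ -rows_in0 -rows_in_mul_seq => i.
have := image_valP a; rewrite unfold_in => /asboolP[v av].
by rewrite mxE mulrC; apply: s_socle; rewrite [inclusion n a]av; apply: Fmin.
Qed.

Definition kills_mod (V : lmodType R) : Prop :=
  forall v : V, mul_seq [set 0] xs (s *: v).

Lemma kills_modP (V : lmodType R) : kills_mod V <-> forall v : V,
  exists c : 'I_(size xs) -> V, s *: v = \sum_(i < size xs) xs`_i *: c i.
Proof.
split=> sV v; have := sV v.
  by move/mul_seqP=> [c /= /eqP]; rewrite subr_eq0 => /eqP; exists c.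
by case=> c vc; apply/mul_seqP; exists c; rewrite vc /= subrr.
Qed.

Lemma kills_mod_sum (j : nat -> nat) (Lambda : seq nat) :
    (forall n, n \in Lambda -> (0 < n)%N) ->
  kills_mod (direct_sum (syzygy F) j Lambda).
Proof.
elim: Lambda => [|n Lambda IHn] gt0.
  move=> v; rewrite (_ : s *: v = 0); last by apply/rowP; case.
  exact/sub_mul_seq.
have /kills_modP killsL : kills_mod (direct_sum (syzygy F) j Lambda).
  by apply: IHn => k Lk; apply: gt0; rewrite inE Lk orbT.
have /kills_modP killsn : kills_mod (syzygy F n).
  by move=> a; apply: socle_mul_syzygy; apply: gt0; rewrite mem_head.
apply/kills_modP => -[f w]; have [c wc] := killsL w.
have /choice[b fb] k := killsn (f k).
exists (fun i => ([ffun k => b k i], c i)).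
rewrite [RHS]surjective_pairing !raddf_sum /= -wc; congr (_, _).
apply/ffunP => k; rewrite sum_ffunE ffunE fb; apply: eq_bigr => i _.
by rewrite !ffunE.
Qed.

Lemma kills_mod_image (N L : lmodType R) :
  homomorphic_image N L -> kills_mod N -> kills_mod L.
Proof.
case=> p p_surj /kills_modP killsN; apply/kills_modP => y.
have [v <-] := p_surj y; have [c vc] := killsN v; exists (fun i => p (c i)).
rewrite -linearZ vc linear_sum; apply: eq_bigr => i _; exact: linearZ.
Qed.

End Syzygies.

(** * Constructing linear maps *)

Section LinearChoice.
Variable R : comNzRingType.

Definition linear_relation (A B : lmodType R) (rho : A -> B -> Prop) : Prop :=
  rho 0 0 /\ forall a x x' y y', rho x y -> rho x' y' ->
    rho (a *: x + x') (a *: y + y').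

(** A linear relation that is total and functional is the graph of a linear map;
    most maps below are defined by a diagram chase, which yields a relation. *)
Lemma linear_choice (A B : lmodType R) (rho : A -> B -> Prop) :
    linear_relation rho -> (forall x, exists y, rho x y) ->
    (forall y, rho 0 y -> y = 0) ->
  exists f : {linear A -> B}, forall x y, rho x y <-> y = f x.
Proof.
move=> [rho00 rhoL] /choice[f fP] rho0.
have f_uniq x y : rho x y -> y = f x.
  move=> rho_xy; apply/eqP; rewrite -subr_eq0; apply/eqP/rho0.
  have := rhoL (-1) _ _ _ _ (fP x) rho_xy.
  by rewrite !scaleN1r addNr [X in rho _ X]addrC.
have f_lin : linear f.
  by move=> a x y; symmetry; apply: f_uniq; apply: rhoL.
pose lf := GRing.isLinear.Build R A B *:%R f f_lin.
pose F : {linear A -> B} := HB.pack f lf.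
by exists F => x y; split=> [/f_uniq // | ->]; apply: fP.
Qed.

Section Rows.
Variables (n : nat) (L : lmodType R) (b : 'I_n -> L).

Definition row_comb (v : 'rV[R]_n) : L := \sum_i v 0 i *: b i.

Lemma row_comb_is_linear : linear row_comb.
Proof.
move=> a v w; rewrite /row_comb scaler_sumr -big_split; apply: eq_bigr => i _.
by rewrite /= !mxE scalerDl scalerA.
Qed.

HB.instance Definition _ :=
  GRing.isLinear.Build R 'rV[R]_n L *:%R row_comb row_comb_is_linear.

End Rows.

(** The values on the basis may be chosen freely. *)
Lemma free_choice n (L : lmodType R) (rho : 'rV[R]_n -> L -> Prop) :
    linear_relation rho -> (forall v, exists y, rho v y) ->
  exists f : {linear 'rV[R]_n -> L}, forall v, rho v (f v).
Proof.
move=> [rho00 rhoL] rho_tot; have /choice[b bP] i := rho_tot (delta_mx 0 i).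
exists (row_comb b) => v; rewrite {1}[v]row_sum_delta /= /row_comb.
elim/big_rec2: _ => // i y w _ rho_wy; exact: rhoL.
Qed.

Lemma linear_ext (A B : lmodType R) (f g : {linear A -> B}) : f =1 g -> f = g.
Proof.
case: f g => f [[cf] [cf']] [g [[cg] [cg']]] /= /funext fg; subst g.
by rewrite (Prop_irrelevance cf cg) (Prop_irrelevance cf' cg').
Qed.

End LinearChoice.

(** * Independence of Ext from the resolution *)

Section Comparison.
Variables (R : comNzRingType) (L : lmodType R).
Implicit Types F G : free_resolution L.

Lemma fr_diff0K F w : fr_aug F (fr_diff F 0 w) = 0.
Proof. by apply/fr_exact0; exists w. Qed.

Lemma fr_diffK F i w : fr_diff F i (fr_diff F i.+1 w) = 0.
Proof. by apply/fr_exact; exists w. Qed.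

Definition chain_map F G
    (phi : forall i, {linear 'rV[R]_(fr_rank F i) -> 'rV[R]_(fr_rank G i)}) :=
  (forall v, fr_aug G (phi 0%N v) = fr_aug F v) /\
  forall i v, fr_diff G i (phi i.+1 v) = phi i (fr_diff F i v).

Lemma exists_chain_map F G : exists phi, @chain_map F G phi.
Proof.
pose ok i (phi : {linear 'rV[R]_(fr_rank F i) -> 'rV[R]_(fr_rank G i)}) :=
  forall w, exists u, phi (fr_diff F i w) = fr_diff G i u.
have [phi0 phi0P] : exists
    phi : {linear 'rV[R]_(fr_rank F 0) -> 'rV_(fr_rank G 0)},
    forall v, fr_aug G (phi v) = fr_aug F v.
  apply: (free_choice (rho := fun v u => fr_aug G u = fr_aug F v)).
    by split=> [|a x x' y y' xy xy']; rewrite ?linear0 // !linearP xy xy'.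
  by move=> v; apply: fr_surj.
have ok0 : ok 0%N phi0.
  by move=> w; apply/fr_exact0; rewrite phi0P fr_diff0K.
have step i (phi : {phi | ok i phi}) :
    {psi : {psi | ok i.+1 psi} | forall v,
      fr_diff G i (sval psi v) = sval phi (fr_diff F i v)}.
  apply: cid; case: phi => phi okphi /=.
  have [|v|psi psiP] := @free_choice _ _ _ (fun v u =>
      fr_diff G i u = phi (fr_diff F i v)).
  - by split=> [|a x x' y y' xy xy']; rewrite ?linear0 // !linearP xy xy' -linearP.
  - by have [u uP] := okphi v; exists u.
  have okpsi : ok i.+1 psi.
    by move=> w; apply/fr_exact; rewrite psiP fr_diffK linear0.
  by exists (exist _ psi okpsi).
pose fix phi i : {phi | ok i phi} :=
  if i is k.+1 then sval (step k (phi k)) else exist _ phi0 ok0.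
exists (fun i => sval (phi i)); split=> // i v; exact: (svalP (step i (phi i))).
Qed.

(** The difference of theta and the identity induces zero on L, so a homotopy is
    built degree by degree from the exactness of F. *)
Lemma exists_homotopy F
    (theta : forall i, {linear 'rV[R]_(fr_rank F i) -> 'rV[R]_(fr_rank F i)}) :
  chain_map theta ->
  exists h : forall i, {linear 'rV[R]_(fr_rank F i) -> 'rV[R]_(fr_rank F i.+1)},
    forall i v, theta i.+1 v - v = fr_diff F i.+1 (h i.+1 v) + h i (fr_diff F i v).
Proof.
move=> [theta0 thetaS].
pose ok i (h : {linear 'rV[R]_(fr_rank F i) -> 'rV[R]_(fr_rank F i.+1)}) :=
  forall w, theta i (fr_diff F i w) - fr_diff F i w
            = fr_diff F i (h (fr_diff F i w)).
have [||h0 h0P] := @free_choice _ _ _ (fun v u =>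
    theta 0%N v - v = fr_diff F 0 u).
- split=> [|a x x' y y' xy xy']; first by rewrite !raddf0 addr0.
  by rewrite !linearP addrACA -scalerDr xy xy'.
- move=> v; have [|u uP] := (fr_exact0 (f := F) (theta 0%N v - v)).1.
    by rewrite linearB theta0 subrr.
  by exists u.
have ok0 : ok 0%N h0 by move=> w; apply: h0P.
have step i (h : {h | ok i h}) : {h' : {h' | ok i.+1 h'} | forall v,
    theta i.+1 v - v = fr_diff F i.+1 (sval h' v) + sval h (fr_diff F i v)}.
  apply: cid; case: h => h okh /=.
  have [||h' h'P] := @free_choice _ _ _ (fun v u =>
      theta i.+1 v - v = fr_diff F i.+1 u + h (fr_diff F i v)).
  - split=> [|a x x' y y' xy xy']; first by rewrite !raddf0 !addr0.
    by rewrite !linearP addrACA -scalerDr xy xy' scalerDr addrACA.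
  - move=> v; set z := theta i.+1 v - v - h (fr_diff F i v).
    have [|u uP] := (fr_exact (f := F) z).1.
      by rewrite /z !linearB thetaS okh subrr.
    by exists u; rewrite -uP subrK.
  have okh' : ok i.+1 h'.
    by move=> w; rewrite h'P fr_diffK linear0 addr0.
  by exists (exist _ h' okh').
pose fix h i : {h | ok i h} :=
  if i is k.+1 then sval (step k (h k)) else exist _ h0 ok0.
exists (fun i => sval (h i)) => i v; exact: (svalP (step i (h i))).
Qed.

Definition ext_vanishes F i (N : lmodType R) : Prop :=
  forall f : {linear 'rV[R]_(fr_rank F i.+1) -> N},
    (forall w, f (fr_diff F i.+1 w) = 0) ->
    exists g : {linear 'rV[R]_(fr_rank F i) -> N},
      forall v, f v = g (fr_diff F i v).

(** Let phi and psi be comparison maps between F and G. A cocycle f on G becomes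
    the coboundary of some g on F, and f is cohomologous to f phi psi by a
    homotopy h from phi psi to the identity. *)
Lemma ext_vanishes_indep F G i N : ext_vanishes F i N -> ext_vanishes G i N.
Proof.
move=> extF f fd0.
have [phi [phi0 phiS]] := exists_chain_map F G.
have [psi [psi0 psiS]] := exists_chain_map G F.
have [|h hP] := @exists_homotopy G (fun i => phi i \o psi i).
  by split=> [v | k v] /=; rewrite ?phi0 ?psi0 // phiS psiS.
have [|g gP] := extF (f \o phi i.+1).
  by move=> w; rewrite /= -phiS fd0.
exists ((g \o psi i) \- (f \o h i)) => v /=.
rewrite -psiS -gP /= -(subKr (f (phi i.+1 (psi i.+1 v))) (f v)) -linearB.
by rewrite [phi _ _ - v]hP linearD fd0 add0r.
Qed.

End Comparison.

(** * Semidualizing modules modulo a regular sequence *)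

Section Functional.
Variables (R : comNzRingType) (L : lmodType R) (n : nat).
Variable aug : {linear 'rV[R]_n -> L}.
Hypothesis Lnoeth : noetherian_module L.
Hypothesis aug_surj : forall y, exists v, aug v = y.

(** Take V maximal among the submodules such that no r outside p kills L/V, and
    e outside V; then some r outside p sends L into V + Re. As Re meets V inside
    pe, the coefficient of e in r y is well defined modulo p; it is the value at
    y of a nonzero linear form on L with values in R/p. *)
Lemma exists_linear_form (p : set R^o) :
    is_prime p -> (forall a : R, (forall y : L, a *: y = 0) -> p a) ->
  exists phi : {linear 'rV[R]_n -> R^o},
    (forall v, aug v = 0 -> p (phi v)) /\ exists v, ~ p (phi v).
Proof.
move=> [subp p1 pM] annLp.
have [|V [subV VP Vmax]] := @noetherian_max _ L (fun V =>
    forall r : R, ~ p r -> exists y, ~ V (r *: y)) Lnoeth.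
  exists [set 0]; split; first exact: submod_zero.
  move=> r npr; apply: contrapT => noy; apply/npr/annLp => y.
  by apply: contrapT => ry; apply: noy; exists y.
have [e nVe] : exists e, ~ V e.
  by have [y] := VP 1 p1; rewrite scale1r; exists y.
have [r npr Lr] : exists2 r : R, ~ p r & forall y, add_line V e (r *: y).
  apply: contrapT => nor; apply/nVe/(Vmax (add_line V e)).
  - exact: submod_add_line.
  - move=> r npr; apply: contrapT => noy; apply: nor; exists r => // y.
    by apply: contrapT => ny; apply: noy; exists y.
  - exact: sub_add_line.
  exact: mem_add_line.
have Ve_p (c : R) : V (c *: e) -> p c.
  move=> Vce; apply: contrapT => npc.
  have [|y] := VP (c * r); first by case/pM.
  apply; have [b Vb] := Lr y.
  rewrite -scalerA -(subrK (b *: e) (r *: y)) scalerDr.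
  by apply: submodD => //; rewrite 1?scaleAC; apply: submodZ.
have [||phi phiP] := @free_choice _ n R^o (fun v c =>
    V (r *: aug v - (c : R) *: e)).
- split=> [|a v v' c c' Vv Vv']; last first.
    rewrite linearP scalerDr scaleAC scalerDl opprD addrACA -scalerA -scalerBr.
    exact: subV.2.
  by rewrite linear0 scaler0 scale0r subrr; case: subV.
- by move=> v; have [c] := Lr (aug v); exists c.
exists phi; split=> [v v0|].
  apply: Ve_p; have := phiP v; rewrite v0 scaler0 sub0r => /(submodN subV).
  by rewrite opprK.
have [v ve] := aug_surj e; exists v => pphi; apply: npr.
rewrite -(subrK (phi v) r); apply: (submodD subp) => //.
by apply: Ve_p; rewrite scalerBl -{1}ve; apply: phiP.
Qed.

End Functional.

Section Semidualizing.
Variables (R : comNzRingType) (L : lmodType R) (F : free_resolution L).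
Hypotheses (Rnoeth : noetherian R) (Lnoeth : noetherian_module L).
Hypothesis L_faithful : forall a : R, (forall y : L, a *: y = 0) -> a = 0.

(** R/I is the endomorphism ring of L/K, as Hom(L, L/K), and Ext^i(L, L/K) = 0
    for all i > 0. Maps from a free module to L/K are given by lifts to L. *)
Definition semidualizing_mod (K : set L) (I : set R^o) : Prop :=
  [/\ forall r : R, I r <-> forall y, K (r *: y),
      forall f : {linear 'rV[R]_(fr_rank F 0) -> L},
        (forall w, K (f (fr_diff F 0 w))) ->
        exists r : R, forall v, K (f v - r *: fr_aug F v) &
      forall i (f : {linear 'rV[R]_(fr_rank F i.+1) -> L}),
        (forall w, K (f (fr_diff F i.+1 w))) ->
        exists g : {linear 'rV[R]_(fr_rank F i) -> L},
          forall v, K (f v - g (fr_diff F i v))].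

Variables (K : set L) (I : set R^o).
Hypotheses (subK : submodule K) (KI : semidualizing_mod K I).

(** If x z is in K but z is not, then R/p embeds in L/K for some prime p, the
    annihilator modulo K of a multiple of z, and x kills its image. A nonzero
    map L -> R/p -> L/K is the multiplication by an element of R/I that is not
    zero but is killed by x. *)
Lemma nonzerodivisor_semidualizing (x : R) :
  nonzerodivisor I x -> nonzerodivisor K x.
Proof.
case: KI => KI_I KI_hom _ xI z Kxz; apply: contrapT => nKz.
have [a pr_p] := exists_associated_prime Rnoeth subK nKz.
set y := a *: z in pr_p; have Kxy : K (x *: y).
  by rewrite scaleAC; apply: submodZ.
have [|phi [phi0 [v0 nphi]]] := exists_linear_form Lnoeth (@fr_surj _ _ F) pr_p.
  by move=> b /L_faithful->; case: (submod_colon y subK).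
have f_lin : linear (fun v => (phi v : R) *: y).
  by move=> b v w; rewrite linearP scalerDl -scalerA.
pose f : {linear 'rV[R]_(fr_rank F 0) -> L} :=
  HB.pack (fun v => (phi v : R) *: y) (GRing.isLinear.Build _ _ _ _ _ f_lin).
have [w|r rP] := KI_hom f; first by apply: phi0; rewrite fr_diff0K.
have Ir : I r.
  apply: xI; apply/KI_I => u; have [v <-] := @fr_surj _ _ F u.
  change (K ((x * r) *: fr_aug F v)).
  have -> : (x * r) *: fr_aug F v = (phi v : R) *: (x *: y)
      - x *: (f v - r *: fr_aug F v).
    by rewrite scalerBr opprB addrC scaleAC subrK scalerA.
  by apply: submodB => //; apply: submodZ.
apply: nphi; rewrite /colon /=.
rewrite -[_ *: y](subrK (r *: fr_aug F v0)).
apply: submodD => //; first exact: rP.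
by move/KI_I: Ir; apply.
Qed.

Variable x : R.
Hypothesis xI : nonzerodivisor I x.

Lemma divide_linear n (f : {linear 'rV[R]_n -> L}) :
    (forall v, add_multiples K x (f v)) ->
  exists h : {linear 'rV[R]_n -> L}, forall v, K (f v - x *: h v).
Proof.
move=> fx; apply: (free_choice (rho := fun v y => K (f v - x *: y))) => //.
split=> [|a v v' y y' Kv Kv']; first by rewrite linear0 scaler0 subrr; case: subK.
rewrite linearP scalerDr scaleAC opprD addrACA -scalerBr; exact: subK.2.
Qed.

(** A cocycle f with values in L/(K + xL) lifts to a cocycle with values in L/K,
    as Ext^(i+1)(L, L/K) = 0: f d = x h modulo K, where h is a cocycle modulo K
    as x is regular, so h = h' d modulo K, and f - x h' is a cocycle modulo K. *)
Lemma divide_cocycle i (f : {linear 'rV[R]_(fr_rank F i) -> L}) :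
    (forall w, add_multiples K x (f (fr_diff F i w))) ->
  exists h : {linear 'rV[R]_(fr_rank F i) -> L},
    forall w, K ((f \- (x \*: h)) (fr_diff F i w)).
Proof.
case: KI => _ _ KI_ext fx.
have [h hP] := @divide_linear _ (f \o fr_diff F i) fx.
have [|h' h'P] := KI_ext i h.
  move=> w; apply: (nonzerodivisor_semidualizing xI).
  have := hP (fr_diff F i.+1 w); rewrite /= fr_diffK linear0 sub0r.
  by move/(submodN subK); rewrite opprK.
exists h' => w /=; rewrite -(subrK (x *: h w) (f _)) -addrA -scalerBr.
by apply: submodD => //; [apply: hP | apply: submodZ].
Qed.

(** The long exact sequence of Ext(L, -) for multiplication by x on L/K. *)
Lemma semidualizing_mod_add :
  semidualizing_mod (add_multiples K x) (add_multiples I x).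
Proof.
have [KI_I KI_hom KI_ext] := KI.
have xK := nonzerodivisor_semidualizing xI.
split.
- move=> r; split=> [[c /KI_I Krc] y | rK].
    exists (c *: y); have : K ((r - x * c) *: y) by [].
    by rewrite scalerBl -scalerA.
  have [v|h hP] := @divide_linear _ (r \*: fr_aug F); first exact: rK.
  have [w|c cP] := KI_hom h.
    apply: xK; have := hP (fr_diff F 0 w); rewrite /= fr_diff0K scaler0 sub0r.
    by move/(submodN subK); rewrite opprK.
  exists c; apply/KI_I => y; have [v <-] := @fr_surj _ _ F y.
  change (K ((r - x * c) *: fr_aug F v)).
  have -> : (r - x * c) *: fr_aug F v
      = (r *: fr_aug F v - x *: h v) + x *: (h v - c *: fr_aug F v).
    by rewrite scalerBr addrA subrK scalerBl scalerA.
  by apply: submodD => //; [apply: hP | apply: submodZ].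
- move=> f /divide_cocycle[h /KI_hom[r rP]]; exists r => v; exists (h v).
  by have := rP v; rewrite /= addrAC.
move=> i f /divide_cocycle[h /KI_ext[g gP]]; exists g => v; exists (h v).
by have := gP v; rewrite /= addrAC.
Qed.

End Semidualizing.

Section SemidualizingSequence.
Variables (R : comNzRingType) (L : lmodType R).
Hypotheses (Rnoeth : noetherian R) (Lnoeth : noetherian_module L).
Hypothesis Lsd : semidualizing L.

Lemma semidualizing_faithful (a : R) : (forall y : L, a *: y = 0) -> a = 0.
Proof.
case: Lsd => -[g homK _] _ a0; apply: (can_inj homK); apply: linear_ext => y.
by rewrite /= a0 scale0r.
Qed.

Lemma semidualizing_mod0 (F : free_resolution L) :
  semidualizing_mod F [set 0] [set 0].
Proof.
case: (Lsd) => -[g homK gK] extL; split.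
- move=> r; split=> [-> y | r0]; first by rewrite /= scale0r.
  exact: semidualizing_faithful.
- move=> f fd0.
  have [|y|y|h hP] := @linear_choice _ L L (fun y z =>
      exists2 v, fr_aug F v = y & f v = z).
  + split=> [|a x x' y y' [v <- <-] [v' <- <-]]; first by exists 0; rewrite linear0.
    by exists (a *: v + v'); rewrite linearP.
  + by have [v <-] := @fr_surj _ _ F y; exists (f v), v.
  + by case=> v /fr_exact0[w ->] <-; apply: fd0.
  have fE v : f v = h (fr_aug F v).
    have [v' v'v <-] := (hP (fr_aug F v) _).2 erefl.
    apply/eqP; rewrite -subr_eq0 -linearB.
    have [|w ->] := (fr_exact0 (f := F) (v - v')).1; last by apply/eqP/fd0.
    by rewrite linearB v'v subrr.
  exists (g h) => v; rewrite /= fE -[X in X - _](congr1 (fun k : {linear L -> L} =>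
    k (fr_aug F v)) (gK h)).
  by rewrite /= subrr.
move=> i f fd0; have [F' extF'] := extL i.
have [g' g'P] := ext_vanishes_indep (G := F) extF' fd0.
by exists g' => v; rewrite /= g'P subrr.
Qed.

Lemma semidualizing_mod_seq (F : free_resolution L) (xs : seq R) K I :
    submodule K -> submodule I -> semidualizing_mod F K I ->
    regular_mod I xs -> semidualizing_mod F (mul_seq K xs) (mul_seq I xs).
Proof.
elim: xs K I => [//|x xs IHxs] K I subK subI KI [xI regxs].
apply: IHxs => //; [exact: submod_add_multiples | exact: submod_add_multiples |].
exact: (semidualizing_mod_add Rnoeth Lnoeth semidualizing_faithful).
Qed.

Lemma semidualizing_faithful_mod (xs : seq R) (s : R) :
    regular_mod (V := R^o) [set 0] xs -> kills_mod xs s L ->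
  mul_seq (V := R^o) [set 0] xs s.
Proof.
move=> regxs sL; have [F _] := Lsd.2 0%N.
have [sE _ _] := semidualizing_mod_seq (submod_zero _) (submod_zero _)
  (semidualizing_mod0 F) regxs.
exact/sE.
Qed.

End SemidualizingSequence.

(** * Submodules and quotients as modules *)

Section SubQuotient.
Variables (R : comNzRingType) (V : lmodType R) (K : set V).
Hypothesis subK : submodule K.

Definition submod_pred (_ : submodule K) : {pred V} := fun v => `[< K v >].

Lemma submod_pred_closed : submod_closed (submod_pred subK).
Proof.
split=> [|a x y /asboolP Kx /asboolP Ky]; apply/asboolP; first by case: subK.
exact: subK.2.
Qed.

HB.instance Definition _ :=
  GRing.isSubmodClosed.Build R V (submod_pred subK) submod_pred_closed.

Record submod_type := SubmodType {
  submod_val : V; submod_valP : submod_val \in submod_pred subK }.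

HB.instance Definition _ := [isSub for submod_val].
HB.instance Definition _ := [Choice of submod_type by <:].
HB.instance Definition _ := [SubChoice_isSubLmodule of submod_type by <:].

Lemma exists_submodule : exists (S : lmodType R) (i : {linear S -> V}),
  injective i /\ forall v, K v <-> exists x, v = i x.
Proof.
exists submod_type, [the {linear submod_type -> V} of \val]; split.
  exact: val_inj.
move=> v; split=> [Kv | [x ->]]; last exact/asboolP/(valP x).
have Kv' : v \in submod_pred subK by apply/asboolP.
by exists (SubmodType Kv').
Qed.

Definition quotient_module := Quotient.quot (submod_pred subK).
HB.instance Definition _ := GRing.Zmodule.on quotient_module.

Definition quotient_class (v : V) : quotient_module :=
  (\pi_(Quotient.quot (submod_pred subK)) v)%qT.

Lemma quotient_classP v w : quotient_class v = quotient_class w <-> K (v - w).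
Proof.
split=> [/eqP | Kvw]; last apply/eqP; rewrite -[_ == _]Quotient.idealrBE.
  by move/asboolP.
exact/asboolP.
Qed.

Lemma quotient_classD v w :
  quotient_class (v + w) = quotient_class v + quotient_class w.
Proof. exact: Quotient.pi_add. Qed.

Definition quotient_scale (a : R) (q : quotient_module) : quotient_module :=
  quotient_class (a *: repr q).

Lemma quotient_repr q : quotient_class (repr q) = q.
Proof. exact: reprK. Qed.

Lemma quotient_scaleE a v :
  quotient_scale a (quotient_class v) = quotient_class (a *: v).
Proof.
apply/quotient_classP; rewrite -scalerBr; apply: submodZ => //.
by apply/quotient_classP; rewrite quotient_repr.
Qed.

Lemma quotient_scaleA a b q :
  quotient_scale a (quotient_scale b q) = quotient_scale (a * b) q.
Proof. by rewrite -[q]quotient_repr !quotient_scaleE scalerA. Qed.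

Lemma quotient_scale1 : left_id 1 quotient_scale.
Proof. by move=> q; rewrite -[q]quotient_repr quotient_scaleE scale1r. Qed.

Lemma quotient_scaleDr : right_distributive quotient_scale +%R.
Proof.
move=> a q r; rewrite -[q]quotient_repr -[r]quotient_repr -quotient_classD.
by rewrite !quotient_scaleE scalerDr quotient_classD.
Qed.

Lemma quotient_scaleDl q :
  {morph quotient_scale^~ q : a b / a + b >-> a + b}.
Proof.
move=> a b; rewrite -[q]quotient_repr !quotient_scaleE scalerDl.
exact: quotient_classD.
Qed.

HB.instance Definition _ := GRing.Zmodule_isLmodule.Build R quotient_module
  quotient_scaleA quotient_scale1 quotient_scaleDr quotient_scaleDl.

Lemma quotient_class_is_linear : linear quotient_class.
Proof. by move=> a v w; rewrite quotient_classD -quotient_scaleE. Qed.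

HB.instance Definition _ := GRing.isLinear.Build R V quotient_module *:%R
  quotient_class quotient_class_is_linear.

Lemma exists_quotient : exists (Q : lmodType R) (p : {linear V -> Q}),
  (forall y, exists v, p v = y) /\ forall v, p v = 0 <-> K v.
Proof.
exists quotient_module, [the {linear V -> quotient_module} of quotient_class].
split=> [y | v]; first by exists (repr y); apply: quotient_repr.
by rewrite -(linear0 quotient_class) quotient_classP subr0.
Qed.

End SubQuotient.

(** * Finite injective dimension *)

Section InjectiveDimension.
Variables (R : comNzRingType).
Implicit Types (X I : set R^o) (A B C D E J L N T : lmodType R).

Definition killed_by X N : Prop := forall (a : R) (y : N), X a -> a *: y = 0.

(** E is an injective R/X-module. *)
Definition injective_over X E : Prop :=
  killed_by X E /\
  forall A B (i : {linear A -> B}) (f : {linear A -> E}),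
    injective i -> killed_by X B ->
    exists g : {linear B -> E}, forall x, g (i x) = f x.

Fixpoint inj_dim_le X n N : Prop :=
  if n is n'.+1 then
    exists E C (i : {linear N -> E}) (q : {linear E -> C}),
      [/\ injective_over X E, injective i, (forall c, exists e, q e = c),
          forall e, q e = 0 <-> exists y, e = i y & inj_dim_le X n' C]
  else injective_over X N.

Lemma linear_inj A B (f : {linear A -> B}) :
  (forall x, f x = 0 -> x = 0) -> injective f.
Proof.
move=> f0 x y fxy; apply/eqP; rewrite -subr_eq0; apply/eqP/f0.
by rewrite linearB fxy subrr.
Qed.

(** Multiplication by r embeds R/(I : r) in R/I, and u stands for a homomorphism
    from R/(I : r) to N, to be extended along this embedding. *)
Definition extends_multiples X N : Prop :=
  forall I (r : R) (u : N), submodule I -> X `<=` I ->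
    (forall a : R, I (a * r) -> a *: u = 0) ->
  exists2 w, (forall a : R, I a -> a *: w = 0) & r *: w = u.

Lemma injective_extends_multiples X E :
  submodule X -> injective_over X E -> extends_multiples X E.
Proof.
move=> subX [XE injE] I r u subI XI Iu.
have [A [pA [pA_surj pA0]]] := exists_quotient (submod_colon (V := R^o) r subI).
have [B [pB [pB_surj pB0]]] := exists_quotient subI.
have [||y [a a0 <-]|i iP] := @linear_choice _ A B (fun x y =>
    exists2 a : R, pA a = x & pB (a * r : R) = y).
- split=> [|a x x' y y' [b <- <-] [b' <- <-]].
    by exists 0; rewrite ?mul0r linear0.
  by exists (a * b + b'); rewrite -?linearP // mulrDl -mulrA.
- by move=> x; have [a <-] := pA_surj x; exists (pB ((a : R) * r : R)), a.
- by apply/pB0; move/pA0: a0.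
have [||y [a a0 <-]|f fP] := @linear_choice _ A E (fun x y =>
    exists2 a : R, pA a = x & a *: u = y).
- split=> [|a x x' y y' [b <- <-] [b' <- <-]].
    by exists 0; rewrite ?scale0r ?linear0.
  by exists (a * b + b'); rewrite -?linearP // scalerDl -scalerA.
- by move=> x; have [a <-] := pA_surj x; exists ((a : R) *: u), a.
- by apply: Iu; move/pA0: a0.
have [|a y Xa|g gP] := injE A B i f.
- apply: linear_inj => x ix0; have [a ax] := pA_surj x; rewrite -ax.
  apply/pA0/pB0; rewrite -ix0; apply/iP; by exists a.
- have [b <-] := pB_surj y; rewrite -linearZ; apply/pB0.
  by rewrite /= [_ *: _]mulrC; apply: (ideal_mull _ subI); apply: XI.
have gE (a : R) : a *: g (pB 1) = g (pB a).
  by rewrite -linearZ -linearZ [_ *: _]mulr1.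
exists (g (pB 1)) => [a Ia|]; first by rewrite gE (pB0 a).2 // linear0.
rewrite gE; have -> : pB r = i (pA 1) by apply/iP; exists 1; rewrite ?mul1r.
by rewrite gP; symmetry; apply/fP; exists 1; rewrite ?scale1r.
Qed.

Lemma killed_add_line I (r : R) N (y : N) :
    (forall a : R, I a -> a *: y = 0) -> r *: y = 0 ->
  forall a : R, add_line I r a -> a *: y = 0.
Proof.
move=> Iy ry a [t Iat]; rewrite -(subrK (t * r) a) scalerDl -scalerA ry scaler0.
by rewrite addr0; apply: Iy.
Qed.

Section Artinian.
Variables (m : set R) (X : set R^o) (s : R).
Hypothesis Rnoeth : noetherian R.
Hypotheses (subX : submodule X) (s_socle : forall a : R, X (a * s) <-> m a).
Hypothesis X_socle : forall I, submodule I -> X `<=` I -> ~ I 1 ->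
  exists r : R, ~ I r /\ forall a : R, I (a * r) <-> m a.

(** Over an artinian local ring a module of finite injective dimension is
    injective; only homomorphisms between cyclic modules are needed. *)
Lemma inj_dim_extends_multiples n N : inj_dim_le X n N -> extends_multiples X N.
Proof.
have Xm : X `<=` m by move=> a Xa; apply/s_socle; apply: ideal_mulr.
elim: n N => [|n IHn] N; first exact: injective_extends_multiples.
case=> E [C [i [q [injE i_inj q_surj q0 /IHn{IHn} extC]]]].
have extE := injective_extends_multiples subX injE.
(* Ext^1(R/I, N) = 0, for the residue field and then for all I. *)
have lift_m c : (forall a : R, m a -> a *: c = 0) ->
    exists2 e, (forall a : R, m a -> a *: e = 0) & q e = c.
  move=> mc; have [//|a /s_socle/mc //|c' _ <-] := extC X s c subX.
  have [e <-] := q_surj c'; exists (s *: e); last by rewrite linearZ.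
  by move=> a ma; rewrite scalerA; apply: injE.1; apply/s_socle.
have lift I c : submodule I -> X `<=` I -> (forall a : R, I a -> a *: c = 0) ->
    exists2 e, (forall a : R, I a -> a *: e = 0) & q e = c.
  move=> subI XI Ic; apply: contrapT => noe.
  have [|J [subJ [XJ [b Jb nob]] Jmax]] := @noetherian_max _ R^o (fun I =>
      X `<=` I /\ exists2 c : C, (forall a : R, I a -> a *: c = 0) &
        ~ exists2 e, (forall a : R, I a -> a *: e = 0) & q e = c)
      (noetherian_regular Rnoeth).
    by exists I; split=> //; split=> //; exists c.
  have J1 : ~ J 1.
    move=> J1; apply: nob; exists 0; first by move=> a _; rewrite scaler0.
    by rewrite linear0 -[b]scale1r Jb.
  have [r [nJr Jr]] := X_socle subJ XJ J1.
  have [|e0 me0 qe0] := lift_m (r *: b).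
    by move=> a /Jr Jar; rewrite scalerA Jb.
  have [//|a /Jr|w Jw rw] := extE J r e0 subJ; first exact: me0.
  apply/nJr/(Jmax (add_line J r)); last exact: (mem_add_line (V := R^o) subJ).
  - exact: submod_add_line.
  - split; first by move=> a /XJ; apply: (@sub_add_line _ R^o).
    exists (b - q w).
      apply: killed_add_line => [a Ja|].
        by rewrite scalerBr Jb // -linearZ Jw // linear0 subrr.
      by rewrite scalerBr -linearZ rw qe0 subrr.
    case=> e Je qe; apply: nob; exists (w + e).
      move=> a Ja; rewrite scalerDr Jw // Je ?addr0 //.
      exact: (sub_add_line (V := R^o) r Ja).
    by rewrite linearD qe addrC subrK.
  exact: (sub_add_line (V := R^o)).
move=> I r u subI XI Iu.
have [//|a /Iu|w Iw rw] := extE I r (i u) subI.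
  by rewrite -linearZ => ->; rewrite linear0.
have q_iu : q (i u) = 0 by apply/q0; exists u.
have [||e' Ie' qe'] :=
    lift (add_line I r) (q w) (submod_add_line (V := R^o) subI r).
- by move=> a /XI; apply: (sub_add_line (V := R^o)).
- apply: killed_add_line => [a Ia|]; first by rewrite -linearZ Iw // linear0.
  by rewrite -linearZ rw.
have [|w' w'E] := (q0 (w - e')).1; first by rewrite linearB qe' subrr.
have re' : r *: e' = 0 by apply: Ie'; apply: (mem_add_line (V := R^o)).
exists w' => [a Ia|]; apply: i_inj; rewrite linearZ_LR -w'E scalerBr.
  by rewrite Iw // Ie' ?subrr ?linear0 //; apply: (sub_add_line (V := R^o)).
by rewrite rw re' subr0.
Qed.

End Artinian.

Section Reduction.
Variables (X : set R^o) (x : R).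
Hypotheses (subX : submodule X) (xX : nonzerodivisor X x).
Let X' : set R^o := add_multiples X x.

Definition divisible N : Prop := forall y : N, exists z, y = x *: z.

Definition torsion_of T N (i : {linear T -> N}) : Prop :=
  injective i /\ forall y, x *: y = 0 <-> exists t, y = i t.

Lemma exists_torsion N : exists T (i : {linear T -> N}), torsion_of i.
Proof.
have subT : submodule [set y : N | x *: y = 0].
  split=> [|a y z /= y0 z0]; first by rewrite /= scaler0.
  by rewrite /= scalerDr scaleAC y0 z0 scaler0 addr0.
by have [T [i iP]] := exists_submodule subT; exists T, i.
Qed.

Lemma injective_divisible E : injective_over X E -> divisible E.
Proof.
move=> injE y.
have [//|a|z _ zy] :=
  injective_extends_multiples subX injE subX (r := x) (u := y).
  by rewrite mulrC => /xX; apply: injE.1.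
by exists z.
Qed.

Lemma injective_torsion E T (i : {linear T -> E}) :
  injective_over X E -> torsion_of i -> injective_over X' T.
Proof.
move=> [XE injE] [i_inj iT].
have ix t : x *: i t = 0 by apply/iT; exists t.
split=> [a t [c Xac] | A B j f j_inj X'B].
  apply: i_inj; rewrite linearZ_LR linear0 -(subrK (x * c : R) a) scalerDl.
  by rewrite XE // mulrC -scalerA ix scaler0 addr0.
have X_B : killed_by X B by move=> a b Xa; apply: X'B; apply: sub_add_multiples.
have [g gP] := injE A B j (i \o f) j_inj X_B.
have X'x : X' x.
  by have := mem_add_multiples (V := R^o) subX x 1; rewrite [_ *: _]mulr1.
have [||t|h hP] := @linear_choice _ B T (fun b t => i t = g b).
- by split=> [|a b b' t t' bt bt']; rewrite ?linear0 // !linearP bt bt'.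
- move=> b; have [|t tP] := (iT (g b)).1; last by exists t.
  by rewrite -linearZ X'B // linear0.
- by rewrite linear0 -(linear0 i) => /i_inj.
by exists h => a; symmetry; apply/hP; rewrite gP.
Qed.

(** The functor of x-torsion, which is Hom(R/x, -), is exact on the short exact
    sequences with x-divisible kernel that make up an injective resolution. *)
Lemma inj_dim_torsion n C T (i : {linear T -> C}) :
  inj_dim_le X n C -> divisible C -> torsion_of i -> inj_dim_le X' n T.
Proof.
elim: n C T i => [|n IHn] C T i; first by move=> injC _; apply: injective_torsion.
case=> E [C' [j [q [injE j_inj q_surj q0 dimC']]]] divC [i_inj iT].
have divE := injective_divisible injE.
have [TE [iE torE]] := exists_torsion E; have [iE_inj iET] := torE.
have [TC [iC torC]] := exists_torsion C'; have [iC_inj iCT] := torC.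
have [||t|k kP] := @linear_choice _ T TE (fun t e => iE e = j (i t)).
- by split=> [|a y y' z z' yz yz']; rewrite ?linear0 // !linearP yz yz'.
- move=> t; have [|e eP] := (iET (j (i t))).1; last by exists e.
  by rewrite -linearZ (iT _).2 ?linear0 //; exists t.
- by rewrite !linear0 -(linear0 iE) => /iE_inj.
have [||t|p pP] := @linear_choice _ TE TC (fun e c => iC c = q (iE e)).
- by split=> [|a y y' z z' yz yz']; rewrite ?linear0 // !linearP yz yz'.
- move=> e; have [|c cP] := (iCT (q (iE e))).1; last by exists c.
  by rewrite -linearZ (iET _).2 ?linear0 //; exists e.
- by rewrite !linear0 -(linear0 iC) => /iC_inj.
have kE t : iE (k t) = j (i t) by apply/kP.
have pE e : iC (p e) = q (iE e) by apply/pP.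
exists TE, TC, k, p; split.
- exact: injective_torsion injE torE.
- by move=> t t' ktt'; apply/i_inj/j_inj; rewrite -!kE ktt'.
- move=> c; have [e qe] := q_surj (iC c).
  have [|y xey] := (q0 (x *: e)).1.
    by rewrite linearZ_LR qe; apply/iCT; exists c.
  have [z yz] := divC y.
  have [|t tE] := (iET (e - j z)).1.
    by rewrite scalerBr xey yz linearZ_LR subrr.
  exists t; apply: iC_inj; rewrite pE -tE linearB qe.
  by rewrite (q0 (j z)).2 ?subr0 //; exists z.
- move=> e; split=> [pe0 | [t ->]].
    have [|y ye] := (q0 (iE e)).1; first by rewrite -pE pe0 linear0.
    have [|t tE] := (iT y).1.
      by apply: j_inj; rewrite linearZ_LR linear0 -ye; apply/iET; exists e.
    by exists t; apply: iE_inj; rewrite kE -tE.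
  by apply: iC_inj; rewrite pE kE linear0; apply/q0; exists (i t).
apply: IHn dimC' _ torC => c; have [e <-] := q_surj c; have [z ->] := divE e.
by exists (q z); rewrite linearZ_LR.
Qed.

End Reduction.

Section InjectiveKernel.
Variables (X : set R^o) (J D N : lmodType R).
Variables (j : {linear J -> D}) (p : {linear D -> N}).
Hypotheses (injJ : injective_over X J) (j_inj : injective j).
Hypotheses (p_surj : forall y, exists d, p d = y).
Hypothesis p0 : forall d, p d = 0 <-> exists z, d = j z.

(** As J is injective, D is the direct sum of J and N. *)
Lemma injective_quotient : injective_over X D -> injective_over X N.
Proof.
move=> [XD injD].
have [r rj] := injJ.2 J D j [the {linear J -> J} of idfun] j_inj XD.
have [||d|k kP] := @linear_choice _ N D (fun y d =>
    exists2 d', p d' = y & d' - j (r d') = d).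
- split=> [|a y y' d d' [e <- <-] [e' <- <-]].
    by exists 0; rewrite ?linear0 ?addr0.
  exists (a *: e + e'); first exact: linearP.
  by rewrite !linearP addrACA -scalerDr.
- by move=> y; have [d <-] := p_surj y; exists (d - j (r d)), d.
- by case=> d' /p0[z ->] <-; rewrite rj subrr.
have pk y : p (k y) = y.
  have [d <- <-] := (kP y _).2 erefl; rewrite linearB.
  by rewrite (p0 (j _)).2 ?subr0 //; exists (r d).
split=> [a y Xa | A B i f i_inj XB].
  by rewrite -(pk y) -linearZ XD // linear0.
have [g gP] := injD A B i (k \o f) i_inj XB.
by exists (p \o g) => z; rewrite /= gP /= pk.
Qed.

End InjectiveKernel.

(** If D embeds in an injective E with cokernel C, then N = D/J embeds in E/J,
    which is again injective, with the same cokernel C. *)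
Lemma inj_dim_quotient X n J D N (j : {linear J -> D}) (p : {linear D -> N}) :
    injective_over X J -> injective j -> (forall y, exists d, p d = y) ->
    (forall d, p d = 0 <-> exists z, d = j z) ->
  inj_dim_le X n D -> inj_dim_le X n N.
Proof.
move=> injJ j_inj p_surj p0.
case: n => [|n]; first exact: injective_quotient p0.
case=> E [C [i [q [injE i_inj q_surj q0 dimC]]]].
have sub_img : submodule [set e : E | exists z, e = i (j z)].
  split=> [|a e e' [z ->] [z' ->]]; first by exists 0; rewrite !linear0.
  by exists (a *: z + z'); rewrite !linearP.
have [Q [pi [pi_surj pi0]]] := exists_quotient sub_img.
have [||y [d d0 <-]|k kP] := @linear_choice _ N Q (fun y e =>
    exists2 d, p d = y & pi (i d) = e).
- split=> [|a y y' d d' [e <- <-] [e' <- <-]].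
    by exists 0; rewrite !linear0.
  by exists (a *: e + e'); rewrite !linearP.
- by move=> y; have [d <-] := p_surj y; exists (pi (i d)), d.
- by apply/pi0; have [z ->] := (p0 d).1 d0; exists z.
have [||y [e e0 <-]|h hP] := @linear_choice _ Q C (fun y c =>
    exists2 e, pi e = y & q e = c).
- split=> [|a y y' d d' [e <- <-] [e' <- <-]].
    by exists 0; rewrite !linear0.
  by exists (a *: e + e'); rewrite !linearP.
- by move=> y; have [e <-] := pi_surj y; exists (q e), e.
- by have [z ->] := (pi0 e).1 e0; apply/q0; exists (j z).
have kE d : k (p d) = pi (i d) by symmetry; apply/kP; exists d.
have hE e : h (pi e) = q e by symmetry; apply/hP; exists e.
exists Q, C, k, h; split=> //.
- apply: (injective_quotient (j := i \o j) (p := pi)) => //.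
  by move=> z z' /i_inj/j_inj.
- apply: linear_inj => y; have [d <-] := p_surj y; rewrite kE => /pi0[z /i_inj->].
  by apply/p0; exists z.
- by move=> c; have [e <-] := q_surj c; exists (pi e); rewrite hE.
move=> y; have [e <-] := pi_surj y; rewrite hE; split=> [/q0[d ->] | [z]].
  by exists (p d); rewrite kE.
have [d <-] := p_surj z; rewrite kE => piE.
have [|t] := (pi0 (e - i d)).1; first by rewrite linearB piE subrr.
by move/eqP; rewrite subr_eq -linearD => /eqP->; apply/q0; exists (j t + d).
Qed.

(** With 0 -> N -> E -> C -> 0 and E injective, multiplication by x gives
    0 -> E[x] -> C[x] -> N/xN -> 0, and E[x] is injective modulo x. *)
Lemma inj_dim_mod X (x : R) n N N' (p : {linear N -> N'}) :
    submodule X -> nonzerodivisor X x -> inj_dim_le X n N ->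
    (forall y : N, x *: y = 0 -> y = 0) -> (forall y', exists y, p y = y') ->
    (forall y, p y = 0 <-> exists z, y = x *: z) ->
  inj_dim_le (add_multiples X x) n.-1 N'.
Proof.
move=> subX xX dimN xN p_surj p0; case: n dimN => [injN | n] /=.
  have N'0 (y' : N') : y' = 0.
    have [y <-] := p_surj y'; have [z ->] := injective_divisible subX xX injN y.
    by apply/p0; exists z.
  split=> [a y' _ | A B i f _ _]; first exact: N'0.
  exists [the {linear B -> N'} of \0] => a; by rewrite [RHS]N'0.
case=> E [C [i [q [injE i_inj q_surj q0 dimC]]]].
have divE := injective_divisible subX xX injE.
have divC : divisible x C.
  move=> c; have [e <-] := q_surj c; have [z ->] := divE e.
  by exists (q z); rewrite linearZ_LR.
have qi y : q (i y) = 0 by apply/q0; exists y.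
have [TE [iE torE]] := exists_torsion x E; have [iE_inj iET] := torE.
have [D [iC torC]] := exists_torsion x C; have [iC_inj iCT] := torC.
have [||t|j jP] := @linear_choice _ TE D (fun e c => iC c = q (iE e)).
- by split=> [|a y y' z z' yz yz']; rewrite ?linear0 // !linearP yz yz'.
- move=> e; have [|c cP] := (iCT (q (iE e))).1; last by exists c.
  by rewrite -linearZ (iET _).2 ?linear0 //; exists e.
- by rewrite !linear0 -(linear0 iC) => /iC_inj.
have jE t : iC (j t) = q (iE t) by apply/jP.
have [||y'|delta deltaP] := @linear_choice _ D N' (fun d y' =>
    exists e y, [/\ q e = iC d, x *: e = i y & y' = p y]).
- split=> [|a d d' y y' [e [z [qe xe ->]]] [e' [z' [qe' xe' ->]]]].
    by exists 0, 0; rewrite !linear0.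
  exists (a *: e + e'), (a *: z + z'); rewrite !linearP qe qe'; split=> //.
  by rewrite -xe -xe'.
- move=> d; have [e qe] := q_surj (iC d).
  have [|y xe] := (q0 (x *: e)).1; last by exists (p y), e, y.
  by rewrite linearZ_LR qe; apply/iCT; exists d.
- case=> e [y [qe xe ->]]; rewrite linear0 in qe; have [z eE] := (q0 e).1 qe.
  by apply/p0; exists z; apply: i_inj; rewrite -xe eE linearZ_LR.
have injTE := injective_torsion subX injE torE.
apply: (inj_dim_quotient (j := j) (p := delta) injTE).
- apply: linear_inj => t jt0; have [|y ty] := (q0 (iE t)).1.
    by rewrite -jE jt0 linear0.
  apply: iE_inj; rewrite linear0 ty (xN y) ?linear0 //.
  by apply: i_inj; rewrite linear0 linearZ_LR -ty; apply/iET; exists t.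
- move=> y'; have [y <-] := p_surj y'; have [e ye] := divE (i y).
  have [|d qe] := (iCT (q e)).1; first by rewrite -linearZ_LR -ye.
  by exists d; symmetry; apply/deltaP; exists e, y.
- move=> d; split=> [d0 | [t ->]].
    have [e [y [qe xe]]] := (deltaP d _).2 erefl; rewrite d0 => /esym/p0[z yz].
    have [|t tE] := (iET (e - i z)).1.
      by rewrite scalerBr xe yz linearZ_LR subrr.
    by exists t; apply: iC_inj; rewrite jE -tE linearB qi subr0.
  symmetry; apply/deltaP; exists (iE t), 0; rewrite !linear0 jE; split=> //.
  by apply/iET; exists t.
exact: inj_dim_torsion dimC divC torC.
Qed.

Lemma inj_dim_mod_seq X n L (K : set L) N (p : {linear L -> N}) (xs : seq R) :
    submodule X -> submodule K -> regular_mod X xs -> regular_mod K xs ->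
    inj_dim_le X n N ->
    (forall y, exists v, p v = y) -> (forall v, p v = 0 <-> K v) ->
  exists n' N' (p' : {linear L -> N'}), [/\ inj_dim_le (mul_seq X xs) n' N',
    forall y, exists v, p' v = y & forall v, p' v = 0 <-> mul_seq K xs v].
Proof.
elim: xs X n K N p => [|x xs IHxs] X n K N p subX subK /=.
  by move=> _ _ dimN p_surj p0; exists n, N, p.
move=> [xX regX] [xK regK] dimN p_surj p0.
have subX' := submod_add_multiples subX x.
have subK' := submod_add_multiples subK x.
have [N' [p' [p'_surj p'0]]] := exists_quotient subK'.
have [||y [v v0 <-]|r rP] := @linear_choice _ N N' (fun y z =>
    exists2 v, p v = y & p' v = z).
- split=> [|a y y' d d' [e <- <-] [e' <- <-]].
    by exists 0; rewrite !linear0.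
  by exists (a *: e + e'); rewrite !linearP.
- by move=> y; have [v <-] := p_surj y; exists (p' v), v.
- by apply/p'0/sub_add_multiples/p0.
have rE v : r (p v) = p' v by symmetry; apply/rP; exists v.
apply: (IHxs _ n.-1 _ N' p') => //.
apply: (inj_dim_mod (p := r)) dimN _ _ _ => //.
- move=> y; have [v <-] := p_surj y; rewrite -linearZ => /p0/xK Kv.
  exact/p0.
- by move=> y; have [v <-] := p'_surj y; exists (p v); rewrite rE.
move=> y; have [v <-] := p_surj y; rewrite rE; split=> [/p'0[w Kvw] | [z]].
  exists (p w); apply/eqP; rewrite -subr_eq0 -linearZ -linearB; apply/eqP/p0/Kvw.
have [w <-] := p_surj z; rewrite -linearZ => /eqP; rewrite -subr_eq0 -linearB.
by move=> /eqP/p0 Kvw; apply/p'0; exists w.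
Qed.

Lemma injective_module_over E : injective_module E -> injective_over [set 0] E.
Proof.
move=> injE; split=> [a y -> | A B i f i_inj _]; first exact: scale0r.
exact: injE.
Qed.

Lemma finite_inj_dim L : finite_injective_dimension L ->
  exists n, inj_dim_le [set 0] n L.
Proof.
case=> n [E E0].
suff dimN k i N (f : {linear N -> ir_obj E i}) : injective f ->
    (forall v, ir_diff E i v = 0 <-> exists w, v = f w) -> (i + k)%N = n.+1 ->
    inj_dim_le [set 0] k N.
  exists n.+1; apply: (dimN _ 0%N _ (ir_aug E)) => //; first exact: ir_inj.
  exact: ir_exact0.
elim: k i N f => [|k IHk] i N f f_inj fE.
  rewrite addn0 => i_n; have N0 (y : N) : y = 0.
    by apply: f_inj; rewrite [LHS]E0 ?[RHS]E0 ?i_n.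
  split=> [a y _ | A B g h _ _]; first exact: N0.
  by exists [the {linear B -> N} of \0] => a; rewrite [RHS]N0.
rewrite addnS -addSn => ik.
exists (ir_obj E i), (image_module (ir_diff E i)), f, (corestrict (ir_diff E i)).
split=> //.
- exact/injective_module_over/ir_injective.
- exact: corestrict_surj.
- move=> e; rewrite -fE; split=> [/corestrict_eq0 // | e0].
  exact: val_inj.
apply: (IHk i.+1 _ [the {linear image_module (ir_diff E i) -> _} of \val]) => //.
  exact: val_inj.
move=> v; rewrite ir_exact; split=> [[w ->] | [w ->]].
  by exists (corestrict (ir_diff E i) w).
by have := image_valP w; rewrite unfold_in => /asboolP.
Qed.

End InjectiveDimension.

(** * Faithfulness of the residue ring on the reduction of L *)

Section Conclusion.
Variables (R : comNzRingType) (m : set R).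
Hypotheses (Rnoeth : noetherian R) (Rloc : local_ring_with m).
Variables (d : nat) (dimR : krull_dim_eq R d).

Lemma krull_dim_uniq e : krull_dim_eq R e -> e = d.
Proof.
move=> [[p pe] maxe]; case: dimR => [[q qd] maxd].
by apply/eqP; rewrite eqn_leq (maxe _ _ qd) (maxd _ _ pe).
Qed.

Lemma depth_regular (V : lmodType R) e :
    depth_eq m V e -> krull_dim_eq R e ->
  exists xs, [/\ forall x, x \in xs -> m x, size xs = d &
    regular_mod (V := V) [set 0] xs].
Proof.
move=> [[xs [mxs /regular_sequence_mod regxs <-]] _] /krull_dim_uniq szxs.
by exists xs.
Qed.

Lemma exists_common_parameters n (V : nat -> lmodType R) :
    (forall i, (i < n)%N -> finitely_generated (V i) /\
       exists e, depth_eq m (V i) e /\ krull_dim_eq R e) ->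
  exists xs, [/\ forall x, x \in xs -> m x, size xs = d &
    forall i, (i < n)%N -> regular_mod (V := V i) [set 0] xs].
Proof.
move=> VP; apply: (common_regular Rnoeth Rloc) => i ltin.
have [Vfg [e [depthV dimV]]] := VP i ltin.
split; [exact: fin_gen_noetherian | exact: submod_zero |].
exact: depth_regular depthV dimV.
Qed.

Lemma finitely_generated_regular : finitely_generated (R^o : lmodType R).
Proof.
exists 1%N, (fun=> 1) => x; exists (fun=> x).
by rewrite big_ord1 [_ *: _]mulr1.
Qed.

Variables (xs : seq R).
Hypotheses (mxs : forall x, x \in xs -> m x) (size_xs : size xs = d).
Hypothesis regR : regular_mod (V := R^o) [set 0] xs.
Let X : set R^o := mul_seq (V := R^o) [set 0] xs.
Let subX : submodule X := submod_params xs.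

Lemma params_act (V : lmodType R) (a : R) (v : V) :
  X a -> mul_seq [set 0] xs (a *: v).
Proof.
case/mul_seqP => c /= /eqP; rewrite subr_eq0 => /eqP ->.
apply/mul_seqP; exists (fun i => (c i : R) *: v).
rewrite scaler_suml.
rewrite (eq_bigr _ (fun i _ => scalerA _ _ _)) /=; exact: subrr.
Qed.

Lemma params_socle (I : set R^o) : submodule I -> X `<=` I -> ~ I 1 ->
  exists r : R, ~ I r /\ forall a : R, I (a * r) <-> m a.
Proof.
move=> subI XI I1.
have [a Xa|r [nIr rP]] := exists_socle Rnoeth Rloc dimR size_xs regR subI _ I1.
  by rewrite [_ *: _]mulr1; apply: XI.
by exists r; move: nIr rP; rewrite [r *: _]mulr1.
Qed.

Lemma params_proper (V : lmodType R) : finitely_generated V -> nonzero_module V ->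
  exists z : V, ~ mul_seq [set 0] xs z.
Proof.
move=> Vfg [z z0]; apply: (mul_seq_proper Rnoeth Rloc) => //.
- exact: fin_gen_noetherian.
- exact: submod_zero.
by exists z.
Qed.

Lemma params_neq1 : ~ X 1.
Proof.
move=> X1; have [|z] := params_proper finitely_generated_regular.
  by exists 1; apply/eqP/oner_neq0.
by apply; have := ideal_mull z subX X1; rewrite mulr1.
Qed.

Lemma finite_free_faithful_mod (L : lmodType R) (s : R) :
  finite_free L -> nonzero_module L -> kills_mod xs s L -> X s.
Proof.
case=> -[|n] [f f_bij] [y y0] /kills_modP sL.
  by case: f_bij y0 => g _ fK; rewrite -(fK y) [g y]thinmx0 linear0.
have [g gK fK] := f_bij; have [c sc] := sL (f (delta_mx 0 ord0)).
apply/mul_seqP; exists (fun i => g (c i) 0 ord0); rewrite /=.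
have -> : s = (s *: delta_mx 0 ord0 : 'rV[R]_n.+1) 0 ord0.
  by rewrite !mxE !eqxx mulr1.
rewrite -[_ *: _]gK linearZ_LR sc.
have -> : \sum_(i < size xs) xs`_i *: c i
    = f (\sum_(i < size xs) xs`_i *: g (c i)).
  by rewrite linear_sum; apply: eq_bigr => i _; rewrite linearZ_LR fK.
rewrite gK summxE; apply/eqP; rewrite subr_eq0; apply/eqP/eq_bigr => i _.
by rewrite mxE.
Qed.

(** A nonzero socle element u of L/XL is s w for some w, as the map s -> u from
    the ideal (s) of R/X, a copy of the residue field, extends to R/X. *)
Lemma finite_inj_dim_faithful_mod (L : lmodType R) (s : R) :
    finitely_generated L -> nonzero_module L ->
    regular_mod (V := L) [set 0] xs -> finite_injective_dimension L ->
    (forall a : R, X (a * s) <-> m a) ->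
  ~ kills_mod xs s L.
Proof.
move=> Lfg Lneq0 regL /finite_inj_dim[n dimL] sX sL.
have [n' [N [p [dimN p_surj p0]]]] := inj_dim_mod_seq
  (p := [the {linear L -> L} of idfun]) (submod_zero _) (submod_zero _) regR regL
  dimL (fun y => ex_intro _ y erefl) (fun v => conj id id).
have [z nXz] := params_proper Lfg Lneq0.
have subXL : submodule (mul_seq (V := L) [set 0] xs).
  exact/submod_mul_seq/submod_zero.
have [a Xa|b [nXb bP]] := exists_socle Rnoeth Rloc dimR size_xs regR subXL _ nXz.
  exact: params_act.
have [//|a /sX ma|w _ sw] := inj_dim_extends_multiples Rnoeth
    subX sX params_socle dimN (I := X) (r := s) (u := p (b *: z)) subX.
  by rewrite -linearZ; apply/p0/bP.
apply/nXb/p0; rewrite -sw; have [v <-] := p_surj w.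
by rewrite -linearZ; apply/p0/sL.
Qed.

End Conclusion.

Unset Implicit Arguments.

Theorem theorem3p3 (R : comNzRingType) (m : set R)
    (R_noetherian : noetherian R) (R_local : local_ring_with m)
    (R_CM : cohen_macaulay m)
    (M : lmodType R) (M_fg : finitely_generated M)
    (M_MCM : maximal_cohen_macaulay m M)
    (F : free_resolution M) (F_minimal : minimal_resolution m F)
    (Lambda : seq nat) (j : nat -> nat)
    (Lambda_uniq : uniq Lambda)
    (Lambda_gt0 : forall n, n \in Lambda -> (0 < n)%N)
    (j_gt0 : forall n, n \in Lambda -> (0 < j n)%N)
    (L : lmodType R) (L_fg : finitely_generated L)
    (L_neq0 : nonzero_module L)
    (L_image : homomorphic_image (direct_sum (syzygy F) j Lambda) L) :
  ~ semidualizing L /\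
  ~ finite_free L /\
  ~ (maximal_cohen_macaulay m L /\ finite_injective_dimension L).
Proof.
have [d [depthR dimR]] := R_CM; have [_ depthM] := M_MCM.
have socle xs (mxs : forall x, x \in xs -> m x) (szxs : size xs = d)
    (regR : regular_mod (V := R^o) [set 0] xs) :
    regular_mod (V := M) [set 0] xs ->
    exists s : R, [/\ ~ mul_seq (V := R^o) [set 0] xs s,
      forall a : R, mul_seq (V := R^o) [set 0] xs (a * s) <-> m a &
      kills_mod xs s L].
  move=> regM; have X1 := params_neq1 R_noetherian R_local mxs.
  have [s [nXs sX]] := params_socle R_noetherian R_local dimR szxs regR
    (submod_params xs) (fun _ => id) X1.
  exists s; split=> //; apply: kills_mod_image L_image _.
  by apply: kills_mod_sum Lambda_gt0 => //; [exact: F_minimal | move=> r /sX].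
have regRM : exists xs, [/\ forall x, x \in xs -> m x, size xs = d,
    regular_mod (V := R^o) [set 0] xs & regular_mod (V := M) [set 0] xs].
  have [|xs [mxs szxs reg]] := exists_common_parameters R_noetherian R_local dimR
      (n := 2) (V := fun i => if i is 0%N then R^o else M).
    case=> [|i] _; last by [].
    by split; [apply: finitely_generated_regular | exists d].
  by exists xs; split=> //; [apply: (reg 0%N) | apply: (reg 1%N)].
split; last split.
- move=> Lsd; have [xs [mxs szxs regR regM]] := regRM.
  have [s [nXs sX sL]] := socle xs mxs szxs regR regM; apply: nXs.
  apply: (semidualizing_faithful_mod R_noetherian _ Lsd regR sL).
  exact: fin_gen_noetherian.
- move=> Lfree; have [xs [mxs szxs regR regM]] := regRM.
  have [s [nXs sX sL]] := socle xs mxs szxs regR regM; apply: nXs.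
  exact: finite_free_faithful_mod Lfree L_neq0 sL.
case=> -[_ depthL] Lid.
have [|xs [mxs szxs reg]] := exists_common_parameters R_noetherian R_local dimR
    (n := 3) (V := fun i => if i is k.+1 then if k is 0%N then M else L else R^o).
  case=> [|[|i]] _ //.
  by split; [apply: finitely_generated_regular | exists d].
have regR := reg 0%N isT.
have [s [_ sX sL]] := socle xs mxs szxs regR (reg 1%N isT).
exact: (finite_inj_dim_faithful_mod R_noetherian R_local dimR mxs szxs regR
  L_fg L_neq0 (reg 2%N isT) Lid sX sL).
Qed.
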